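(* Let $k_1,k_2\ge0$ be integers with $(k_1,k_2)\ne(0,0)$, $k=k_1+k_2$, $\bar p\in(0,1)$, $\bar q=1-\bar p$ and $a(\bar p)=\bar q^{k_1}\bar p^{k_2}$. Let $\acute T=\hat T_1+\dots+\hat T_n$ where $\hat T_1,\dots,\hat T_n$ are i.i.d. $\mathbb{Z}_+$-valued with probability generating function $\frac{a(\bar p)}{1-z+a(\bar p)z^k}$. For $m\ge0$ let $b_{m,\bar p}=\sum_{l=0}^{\lfloor m/k\rfloor}(-1)^l\binom{m-l(k-1)}{l}a(\bar p)^l$. Assume $1-2ka(\bar p)+ka(\bar p)^2>0$, and let $$p=\frac{(1-ka(\bar p))a(\bar p)}{1-(2k-1)a(\bar p)},\qquad \alpha=\frac{n(1-ka(\bar p))^2}{1-2ka(\bar p)+ka(\bar p)^2},$$ $q=1-p$, and $Z\sim\mathrm{NB}(\alpha,p)$. Then $$d_{TV}(\acute T,Z)\le\frac{n}{\alpha q}\sqrt{\frac2\pi}\Bigl(\frac14+n\Bigl(1-\frac{a(\bar p)}{2}(1+a(\bar p))\Bigr)\Bigr)^{-1/2}\Bigl[\sum_{l=1}^\infty\frac{l(l-1)}{2}\bigl|b_{l,\bar p}-q\,b_{l-1,\bar p}\bigr|+\frac{k(k-1)(k-2)}{2}a(\bar p)+k\,a(\bar p)\sum_{l=k}^\infty\frac{l(l-1)}{2}\bigl|b_{l-k+1,\bar p}-q\,b_{l-k,\bar p}\bigr|\Bigr].$$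
   Context: Interpretation: in independent Bernoulli trials with success probability $\bar p$, a $(k_1,k_2)$-event is $k_1$ consecutive failures followed by $k_2$ consecutive successes; $\hat T_j$ is the number of trials between the $(j-1)$th and $j$th occurrence. $\mathrm{NB}(\alpha,p)$: $\mathbf{P}(Z=m)=\binom{\alpha+m-1}{m}p^\alpha q^m$, $m\ge0$. $d_{TV}(Y,X)=\frac12\sum_{m\ge0}|\mathbf{P}(Y=m)-\mathbf{P}(X=m)|$. The parameters match the mean $n(1-ka(\bar p))/a(\bar p)$ and variance $n(1-(2k-1)a(\bar p))/a(\bar p)^2$ of $\acute T$. *)

(* Defs.v *)
From Stdlib Require Import Reals.
From Coquelicot Require Import Coquelicot.
Open Scope R_scope.

Definition a_fun (k1 k2 : nat) (pb : R) : R := (1 - pb) ^ k1 * pb ^ k2.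

Definition b_coef (k : nat) (a : R) (m : nat) : R :=
  sum_f_R0 (fun l => (-1) ^ l * Binomial.C (m - l * (k - 1))%nat l * a ^ l) (Nat.div m k).

Definition conv (f g : nat -> R) (m : nat) : R :=
  sum_f_R0 (fun j => f j * g (m - j)%nat) m.

Definition dirac0 (m : nat) : R := match m with O => 1 | _ => 0 end.

(* pmf of the sum of n i.i.d. variables with pmf f: n-fold convolution *)
Definition conv_pow (n : nat) (f : nat -> R) : nat -> R :=
  Nat.iter n (conv f) dirac0.

(* generalized binomial coefficient binom(alpha+m-1, m) = prod_{i<m} (alpha+i)/(i+1) *)
Fixpoint gbinom (alpha : R) (m : nat) : R :=
  match m with
  | O => 1
  | S m' => gbinom alpha m' * (alpha + INR m') / INR (S m')
  end.

Definition nb_pmf (alpha p : R) (m : nat) : R :=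
  gbinom alpha m * Rpower p alpha * (1 - p) ^ m.

Definition dTV (f g : nat -> R) : R :=
  / 2 * Series (fun m => Rabs (f m - g m)).

(* Main.v *)
(* Stein's method, written for the sequence t of probabilities of the sum and its generating function
   G = f^n. With B(z) = 1/(1 - z + a z^k) one has G' = n (1 - k a z^(k-1)) B G, so that
   (1 - q z) G' = n c(z) G with c(z) = (1 - q z)(1 - k a z^(k-1)) B(z), whereas the negative binomial
   generating function H satisfies (1 - q z) H' = alpha q H. Matching mean and variance means
   c(1) = alpha q / n and c'(1) = 0, hence c(z) - c(1) = (1 - z)^2 K(z), where the l1 norm of K is at
   most sum l(l-1)/2 |c_l|, which is bounded by the bracket of the theorem. Summation by parts against
   the solution of the negative binomial Stein equation, whose increments are at most 1/(alpha q) for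
   test functions bounded by 1/2, gives d_TV <= n/(alpha q) |K|_1 |(1 - z) G|_1.

   For k >= 2, the smoothness |(1 - z) G|_1 is estimated as follows. Nonnegativity of the
   coefficients b_m forces a <= (k-1)^(k-1)/k^k, and then b_(m+1) >= b_m / 2. Therefore f is the
   convolution of a geometric law of parameter 1/2 with another law, and |(1 - z) G|_1 is at most
   twice the mass of the mode of the n-fold convolution of that geometric law, which is small enough.
   For k = 1 the bracket vanishes and the two laws coincide. *)
Require Import Defs.
From Stdlib Require Import Reals Lra Lia FunctionalExtensionality.
From Coquelicot Require Import Coquelicot.
Open Scope R_scope.

(** * Sequences as a ring under convolution *)

(** Generating functions are treated as formal series, so that identities between them are exact
    ring algebra. Analysis enters mainly through values at 1, that is, absolutely convergent sums.
    The factor [(1 - z)^2] is shared out: one [1 - z] is consumed by summation by parts against the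
    Stein solution, the other by the smoothness of [G]. The bounds [k a < 1], and for [k >= 2] also
    [a <= 1/4] and the ratio bound, are all extracted from [f >= 0]. The critical value of [a] is
    the maximum of [x^(k-1) (1 - x)]: a positive root [1/x] of [1 - z + a z^k] satisfies
    [a = x^(k-1) (1 - x)], and [x] plays the role of the ratio [b_(m+1) / b_m]. The constant
    [sqrt (2 / PI)] leaves room: the squared target is at least about [2 / (PI n)], whereas the
    squared bound from the mode behaves like [1 / (PI n)]. This slack pays for replacing [PI] by
    [7/2] and for dropping the [a]-dependent correction. A single summand is the exception and needs
    a direct estimate. *)

Definition seq_add (f g : nat -> R) (m : nat) : R := f m + g m.
Definition seq_opp (f : nat -> R) (m : nat) : R := - f m.
Definition seq_sub (f g : nat -> R) (m : nat) : R := f m - g m.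
Definition seq_shift (f : nat -> R) (m : nat) : R := f (S m).
Definition delta (j m : nat) : R := if Nat.eqb m j then 1 else 0.
Definition scal_seq (r : R) (f : nat -> R) (m : nat) : R := r * f m.
Definition seq_zero (m : nat) : R := 0.
Definition seq_cst (r : R) : nat -> R := scal_seq r dirac0.

Lemma delta_0 : delta 0 = dirac0.
Proof. apply functional_extensionality; intros [|m]; reflexivity. Qed.

Lemma conv_S (f g : nat -> R) (m : nat) :
  conv f g (S m) = f 0%nat * g (S m) + conv (seq_shift f) g m.
Proof.
unfold conv; rewrite decomp_sum by lia; simpl pred; simpl (S m - 0)%nat.
f_equal.
Qed.

Lemma conv_S_r (f g : nat -> R) (m : nat) :
  conv f g (S m) = conv f (seq_shift g) m + f (S m) * g 0%nat.
Proof.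
unfold conv; simpl sum_f_R0; rewrite Nat.sub_diag; f_equal.
apply sum_eq; intros i Hi; unfold seq_shift.
replace (S (m - i)) with (S m - i)%nat by lia; reflexivity.
Qed.

Lemma conv_0 (f g : nat -> R) : conv f g 0%nat = f 0%nat * g 0%nat.
Proof. reflexivity. Qed.

Lemma conv_comm (f g : nat -> R) : conv f g = conv g f.
Proof.
apply functional_extensionality; intros m; revert f g.
induction m as [|m IH]; intros f g.
- rewrite !conv_0; ring.
- rewrite conv_S, conv_S_r, IH; ring.
Qed.

Lemma conv_add_l (f g h : nat -> R) :
  conv (seq_add f g) h = seq_add (conv f h) (conv g h).
Proof.
apply functional_extensionality; intros m; unfold seq_add, conv.
rewrite <- sum_plus; apply sum_eq; intros; ring.
Qed.

Lemma conv_scal_l (r : R) (f g : nat -> R) :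
  conv (scal_seq r f) g = scal_seq r (conv f g).
Proof.
apply functional_extensionality; intros m; unfold scal_seq, conv.
rewrite scal_sum; apply sum_eq; intros; ring.
Qed.

Lemma conv_scal_r (r : R) (f g : nat -> R) :
  conv f (scal_seq r g) = scal_seq r (conv f g).
Proof. rewrite conv_comm, conv_scal_l, conv_comm; reflexivity. Qed.

Lemma seq_shift_conv (f g : nat -> R) :
  seq_shift (conv f g) = seq_add (scal_seq (f 0%nat) (seq_shift g)) (conv (seq_shift f) g).
Proof. apply functional_extensionality; intros m; apply conv_S. Qed.

Lemma conv_assoc (f g h : nat -> R) : conv f (conv g h) = conv (conv f g) h.
Proof.
apply functional_extensionality; intros m; revert f g h.
induction m as [|m IH]; intros f g h.
- rewrite !conv_0; ring.
- rewrite (conv_S (conv f g)), (conv_S f), seq_shift_conv, conv_add_l, conv_scal_l, IH.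
  rewrite conv_0, (conv_S g); unfold seq_add, scal_seq; ring.
Qed.

Lemma conv_delta (j : nat) (f : nat -> R) (m : nat) :
  conv (delta j) f m = if Nat.leb j m then f (m - j)%nat else 0.
Proof.
revert j; induction m as [|m IH]; intros [|j].
- rewrite conv_0; unfold delta; simpl; ring.
- rewrite conv_0; unfold delta; simpl; ring.
- rewrite conv_S.
  replace (seq_shift (delta 0)) with (scal_seq 0 (delta 0)).
  + rewrite conv_scal_l; unfold delta, scal_seq; simpl; ring.
  + apply functional_extensionality; intros i; unfold seq_shift, scal_seq, delta; simpl; ring.
- rewrite conv_S.
  replace (seq_shift (delta (S j))) with (delta j)
    by (apply functional_extensionality; intros i; reflexivity).
  rewrite IH; unfold delta; simpl; ring.
Qed.

Lemma conv_1_l (f : nat -> R) : conv dirac0 f = f.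
Proof.
apply functional_extensionality; intros m.
rewrite <- delta_0, conv_delta; simpl; f_equal; lia.
Qed.

(** These are formal power series, with [dirac0] as 1 and [delta 1] as z; identities between
    generating functions become goals for [ring]. *)
Lemma seq_ring_theory :
  ring_theory seq_zero dirac0 seq_add conv seq_sub seq_opp (@eq (nat -> R)).
Proof.
constructor; intros;
  first [apply conv_1_l | apply conv_comm | apply conv_assoc | apply conv_add_l |
         apply functional_extensionality; intros m;
         unfold seq_add, seq_zero, seq_opp, seq_sub; ring].
Qed.

Add Ring seq_ring : seq_ring_theory.

(** The ring structure has no scalar multiplication, so a scalar is first turned into the product
    with a constant series. *)
Lemma scal_seq_conv (r : R) (f : nat -> R) : scal_seq r f = conv (seq_cst r) f.
Proof. unfold seq_cst; rewrite conv_scal_l, conv_1_l; reflexivity. Qed.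

Lemma conv_diff_S (x : nat -> R) (m : nat) :
  conv (seq_sub dirac0 (delta 1)) x (S m) = x (S m) - x m.
Proof.
replace (conv (seq_sub dirac0 (delta 1)) x) with (seq_sub x (conv (delta 1) x)) by ring.
unfold seq_sub; rewrite conv_delta; simpl; rewrite Nat.sub_0_r; reflexivity.
Qed.

Lemma conv_diff_0 (x : nat -> R) : conv (seq_sub dirac0 (delta 1)) x 0%nat = x 0%nat.
Proof. rewrite conv_0; unfold seq_sub, delta; simpl; ring. Qed.

Lemma conv_pow_S (n : nat) (f : nat -> R) : conv_pow (S n) f = conv f (conv_pow n f).
Proof. reflexivity. Qed.

Lemma conv_pow_mul (n : nat) (f g : nat -> R) :
  conv_pow n (conv f g) = conv (conv_pow n f) (conv_pow n g).
Proof.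
induction n as [|n IH].
- unfold conv_pow; simpl; ring.
- rewrite !conv_pow_S, IH; ring.
Qed.

(* The formal derivative of the generating function. *)
Definition seq_deriv (f : nat -> R) (m : nat) : R := INR (S m) * f (S m).

(* The Euler operator [z d/dz], which carries first moments. *)
Definition seq_euler (f : nat -> R) (m : nat) : R := INR m * f m.

Lemma seq_euler_conv (f g : nat -> R) :
  seq_euler (conv f g) = seq_add (conv (seq_euler f) g) (conv f (seq_euler g)).
Proof.
apply functional_extensionality; intros m; unfold seq_euler, seq_add, conv.
rewrite <- sum_plus, scal_sum; apply sum_eq; intros i Hi.
rewrite minus_INR by exact Hi; ring.
Qed.

(** The weight [m = i + (m - i)] makes [seq_euler] a derivation; [seq_deriv] is its shift, and the
    shift is harmless because [seq_euler] has constant coefficient 0. *)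
Lemma seq_deriv_conv (f g : nat -> R) :
  seq_deriv (conv f g) = seq_add (conv (seq_deriv f) g) (conv f (seq_deriv g)).
Proof.
assert (Hd : forall h, seq_deriv h = seq_shift (seq_euler h)) by reflexivity.
apply functional_extensionality; intros m.
rewrite (Hd (conv f g)), seq_euler_conv; unfold seq_shift at 1, seq_add.
rewrite conv_S, (conv_S_r f); fold (seq_deriv f); rewrite <- !Hd.
unfold seq_euler; simpl (INR 0); ring.
Qed.

Lemma seq_deriv_pow (n : nat) (f w : nat -> R) :
  seq_deriv f = conv w f ->
  seq_deriv (conv_pow n f) = scal_seq (INR n) (conv w (conv_pow n f)).
Proof.
intros Hf; induction n as [|n IH].
- apply functional_extensionality; intros m; unfold seq_deriv, scal_seq, conv_pow; simpl; ring.
- rewrite conv_pow_S, seq_deriv_conv, IH, Hf, conv_scal_r.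
  apply functional_extensionality; intros m.
  replace (conv (conv w f) (conv_pow n f)) with (conv w (conv f (conv_pow n f))) by ring.
  replace (conv f (conv w (conv_pow n f))) with (conv w (conv f (conv_pow n f))) by ring.
  unfold seq_add, scal_seq; rewrite S_INR; ring.
Qed.

Lemma conv_nonneg (f g : nat -> R) :
  (forall m, 0 <= f m) -> (forall m, 0 <= g m) -> forall m, 0 <= conv f g m.
Proof.
intros Hf Hg m; apply cond_pos_sum; intros; apply Rmult_le_pos; auto.
Qed.

Lemma conv_pow_nonneg (n : nat) (f : nat -> R) :
  (forall m, 0 <= f m) -> forall m, 0 <= conv_pow n f m.
Proof.
intros Hf; induction n as [|n IH].
- intros [|m]; unfold conv_pow; simpl; lra.
- rewrite conv_pow_S; apply conv_nonneg; assumption.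
Qed.

(** * Absolutely summable sequences and their tails *)

Lemma is_series_lim (x : nat -> R) (s : R) : is_series x s <-> is_lim_seq (sum_f_R0 x) s.
Proof.
unfold is_series, is_lim_seq; simpl Rbar_locally.
split; apply filterlim_ext; intros n; [symmetry|]; symmetry; rewrite sum_n_Reals; reflexivity.
Qed.

Lemma ex_series_bounded (x : nat -> R) (s : R) :
  (forall m, 0 <= x m) -> (forall N, sum_f_R0 x N <= s) -> ex_series x.
Proof.
intros Hx Hs.
destruct (ex_finite_lim_seq_incr (sum_f_R0 x) s) as [l Hl].
- intros n; simpl; specialize (Hx (S n)); lra.
- exact Hs.
- exists l; apply is_series_lim; exact Hl.
Qed.

Lemma Series_lim (x : nat -> R) : ex_series x -> is_lim_seq (sum_f_R0 x) (Series x).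
Proof. intros H; apply is_series_lim, Series_correct, H. Qed.

Lemma Series_le_bound (x : nat -> R) (s : R) :
  ex_series x -> (forall N, sum_f_R0 x N <= s) -> Series x <= s.
Proof.
intros Hx Hs.
exact (is_lim_seq_le _ _ _ _ Hs (Series_lim x Hx) (is_lim_seq_const s)).
Qed.

Lemma is_series_add (x y : nat -> R) (s r : R) :
  is_series x s -> is_series y r -> is_series (seq_add x y) (s + r).
Proof. intros Hx Hy; exact (is_series_plus x y s r Hx Hy). Qed.

Lemma is_series_scal_seq (c : R) (x : nat -> R) (s : R) :
  is_series x s -> is_series (scal_seq c x) (c * s).
Proof. intros Hx; exact (is_series_scal c x s Hx). Qed.

Lemma is_series_delta (j : nat) (g : nat -> R) :
  is_series (fun m => delta j m * g m) (g j).
Proof.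
apply is_series_lim.
apply is_lim_seq_ext_loc with (u := fun _ => g j); [|apply is_lim_seq_const].
exists j; intros n Hn.
assert (H : forall N, sum_f_R0 (fun m => delta j m * g m) N = if Nat.leb j N then g j else 0).
{ induction N as [|N IH]; simpl sum_f_R0; [|rewrite IH]; unfold delta.
  - destruct j; simpl; ring.
  - destruct (Nat.leb_spec j N), (Nat.leb_spec j (S N)), (Nat.eqb_spec (S N) j);
      try lia; subst; ring. }
rewrite H; destruct (Nat.leb_spec j n); [reflexivity|lia].
Qed.

(** Values at 1 multiply under convolution when convergence is absolute, so the two facts travel
    together. *)
Definition abs_sum (x : nat -> R) (s : R) : Prop :=
  ex_series (fun m => Rabs (x m)) /\ is_series x s.

(** Bounding the partial sums carries convergence along, whereas [Series] returns a default value on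
    divergent input. *)
Definition l1_le (x : nat -> R) (s : R) : Prop :=
  forall N, sum_f_R0 (fun m => Rabs (x m)) N <= s.

Lemma l1_le_ex_series (x : nat -> R) (s : R) :
  l1_le x s -> ex_series (fun m => Rabs (x m)).
Proof. intros H; apply ex_series_bounded with s; [intros; apply Rabs_pos|exact H]. Qed.

Lemma abs_sum_nonneg (x : nat -> R) (s : R) :
  (forall m, 0 <= x m) -> is_series x s -> abs_sum x s.
Proof.
intros Hx Hs; split; [|exact Hs].
exists s; apply is_series_ext with x; [|exact Hs].
intros m; rewrite Rabs_pos_eq; auto.
Qed.

Lemma abs_sum_add (x y : nat -> R) (s r : R) :
  abs_sum x s -> abs_sum y r -> abs_sum (seq_add x y) (s + r).
Proof.
intros [Hx Hxs] [Hy Hys]; split; [|apply is_series_add; assumption].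
apply (ex_series_le (fun m => Rabs (seq_add x y m)) (fun m => Rabs (x m) + Rabs (y m))).
- intros m; unfold norm; simpl; unfold abs; simpl; rewrite Rabs_Rabsolu; apply Rabs_triang.
- exact (ex_series_plus _ _ Hx Hy).
Qed.

Lemma abs_sum_scal (c : R) (x : nat -> R) (s : R) :
  abs_sum x s -> abs_sum (scal_seq c x) (c * s).
Proof.
intros [Hx Hxs]; split; [|apply is_series_scal_seq; assumption].
apply ex_series_ext with (fun m => Rabs c * Rabs (x m)).
- intros m; unfold scal_seq; symmetry; apply Rabs_mult.
- exact (ex_series_scal (Rabs c) _ Hx).
Qed.

Lemma abs_sum_conv (x y : nat -> R) (s r : R) :
  abs_sum x s -> abs_sum y r -> abs_sum (conv x y) (s * r).
Proof.
intros [Hx Hxs] [Hy Hys]; split; [|apply is_series_mult; assumption].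
apply (ex_series_le (fun m => Rabs (conv x y m))
  (conv (fun m => Rabs (x m)) (fun m => Rabs (y m)))).
- intros m; unfold norm; simpl; unfold abs; simpl; rewrite Rabs_Rabsolu; unfold conv.
  eapply Rle_trans; [apply Rsum_abs|]; right.
  apply sum_eq; intros; apply Rabs_mult.
- exists (Series (fun m => Rabs (x m)) * Series (fun m => Rabs (y m))).
  apply is_series_mult_pos; try (intros; apply Rabs_pos); apply Series_correct; assumption.
Qed.

Lemma abs_sum_delta (j : nat) : abs_sum (delta j) 1.
Proof.
apply abs_sum_nonneg.
- intros m; unfold delta; destruct (Nat.eqb m j); lra.
- apply is_series_ext with (fun m => delta j m * 1); [intros; apply Rmult_1_r|].
  exact (is_series_delta j (fun _ => 1)).
Qed.

Lemma seq_euler_delta (j : nat) : seq_euler (delta j) = scal_seq (INR j) (delta j).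
Proof.
apply functional_extensionality; intros m; unfold seq_euler, scal_seq, delta.
destruct (Nat.eqb_spec m j); subst; ring.
Qed.

Lemma abs_sum_pow (n : nat) (f : nat -> R) :
  abs_sum f 1 -> abs_sum (conv_pow n f) 1.
Proof.
intros Hf; induction n as [|n IH].
- unfold conv_pow; simpl; rewrite <- delta_0; apply abs_sum_delta.
- rewrite conv_pow_S, <- (Rmult_1_r 1); apply abs_sum_conv; assumption.
Qed.

Lemma abs_sum_euler_conv (f g : nat -> R) (s r s' r' : R) :
  abs_sum f s -> abs_sum g r -> abs_sum (seq_euler f) s' -> abs_sum (seq_euler g) r' ->
  abs_sum (seq_euler (conv f g)) (s' * r + s * r').
Proof.
intros; rewrite seq_euler_conv; apply abs_sum_add; apply abs_sum_conv; assumption.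
Qed.

Lemma abs_sum_euler_pow (n : nat) (f : nat -> R) (s : R) :
  abs_sum f 1 -> abs_sum (seq_euler f) s -> abs_sum (seq_euler (conv_pow n f)) (INR n * s).
Proof.
intros Hf Hs; induction n as [|n IH].
- unfold conv_pow; simpl Nat.iter; rewrite <- delta_0, seq_euler_delta.
  replace (INR 0 * s) with (INR 0 * 1) by (simpl; ring).
  apply abs_sum_scal, abs_sum_delta.
- rewrite conv_pow_S.
  replace (INR (S n) * s) with (s * 1 + 1 * (INR n * s)) by (rewrite S_INR; ring).
  apply abs_sum_euler_conv; try assumption; apply abs_sum_pow; assumption.
Qed.

Lemma l1_le_conv (x y : nat -> R) (s r : R) :
  l1_le x s -> l1_le y r -> l1_le (conv x y) (s * r).
Proof.
intros Hx Hy N.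
assert (Hr : 0 <= r).
{ eapply Rle_trans; [|apply (Hy 0%nat)]; simpl; apply Rabs_pos. }
(* The induction peels off [x 0], which leaves a convolution with the shifted sequence; hence the
   quantifier over [x]. *)
assert (H : forall N x, sum_f_R0 (fun m => Rabs (conv x y m)) N
  <= sum_f_R0 (fun m => Rabs (x m)) N * r).
{ clear - Hy; induction N as [|N IH]; intros x.
  - simpl; rewrite conv_0, Rabs_mult.
    apply Rmult_le_compat_l; [apply Rabs_pos|exact (Hy 0%nat)].
  - rewrite (decomp_sum (fun m => Rabs (conv x y m))) by lia.
    rewrite (decomp_sum (fun m => Rabs (x m))) by lia; simpl pred.
    apply Rle_trans with (Rabs (x 0%nat) * sum_f_R0 (fun m => Rabs (y m)) (S N)
      + sum_f_R0 (fun m => Rabs (conv (seq_shift x) y m)) N).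
    + rewrite (decomp_sum (fun m => Rabs (y m))) by lia; simpl pred.
      rewrite Rmult_plus_distr_l, Rplus_assoc, scal_sum, <- sum_plus.
      apply Rplus_le_compat; [rewrite conv_0, Rabs_mult; lra|].
      apply sum_Rle; intros m _; rewrite conv_S.
      eapply Rle_trans; [apply Rabs_triang|]; rewrite Rabs_mult; lra.
    + rewrite Rmult_plus_distr_r; apply Rplus_le_compat.
      * apply Rmult_le_compat_l; [apply Rabs_pos|apply Hy].
      * apply IH. }
eapply Rle_trans; [apply H|]; apply Rmult_le_compat_r; [exact Hr|apply Hx].
Qed.

Lemma l1_le_scal (c : R) (x : nat -> R) (s : R) :
  0 <= c -> l1_le x s -> l1_le (scal_seq c x) (c * s).
Proof.
intros Hc Hx N.
apply Rle_trans with (c * sum_f_R0 (fun m => Rabs (x m)) N);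
  [|apply Rmult_le_compat_l; [exact Hc|apply Hx]].
rewrite scal_sum; right; apply sum_eq; intros; unfold scal_seq.
rewrite Rabs_mult, (Rabs_pos_eq c) by exact Hc; ring.
Qed.

Lemma sum_le_Series (x : nat -> R) (N : nat) :
  (forall m, 0 <= x m) -> ex_series x -> sum_f_R0 x N <= Series x.
Proof.
intros Hx He; apply (is_lim_seq_incr_compare (sum_f_R0 x) (Series x) (Series_lim x He)).
intros n; simpl; specialize (Hx (S n)); lra.
Qed.

Lemma l1_le_nonneg (x : nat -> R) (s : R) :
  (forall m, 0 <= x m) -> is_series x s -> l1_le x s.
Proof.
intros Hx Hs N; rewrite <- (is_series_unique x s Hs).
erewrite sum_eq; [|intros; apply Rabs_pos_eq; auto].
apply sum_le_Series; [exact Hx|exists s; exact Hs].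
Qed.

(** * Tail sums and summation by parts *)

Definition tail (x : nat -> R) (m : nat) : R := Series x - sum_f_R0 x m.

Lemma tail_nonneg (x : nat -> R) (N : nat) :
  ex_series x -> (forall j, (N < j)%nat -> 0 <= x j) -> 0 <= tail x N.
Proof.
intros Hx Hpos; unfold tail; apply Rge_le, Rge_minus, Rle_ge.
assert (H : forall i, sum_f_R0 x N <= sum_f_R0 x (i + N)).
{ induction i as [|i IH]; simpl; [lra|].
  specialize (Hpos (S (i + N))); apply Rle_trans with (1 := IH).
  assert (0 <= x (S (i + N))) by (apply Hpos; lia); lra. }
apply (is_lim_seq_le _ _ (sum_f_R0 x N) (Series x) H); [apply is_lim_seq_const|].
apply (is_lim_seq_incr_n (sum_f_R0 x) N), Series_lim, Hx.
Qed.

Lemma tail_lim (x : nat -> R) : ex_series x -> is_lim_seq (tail x) 0.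
Proof.
intros Hx; unfold tail; replace 0 with (Series x - Series x) by ring.
apply is_lim_seq_minus'; [apply is_lim_seq_const|apply Series_lim, Hx].
Qed.

Lemma tail_le (x y : nat -> R) (N : nat) :
  ex_series x -> ex_series y -> (forall j, (N < j)%nat -> x j <= y j) ->
  tail x N <= tail y N.
Proof.
intros Hx Hy Hle.
assert (H : 0 <= tail (fun j => y j - x j) N).
{ apply tail_nonneg; [exact (ex_series_minus _ _ Hy Hx)|].
  intros j Hj; specialize (Hle j Hj); lra. }
unfold tail in *; rewrite Series_minus in H by assumption.
rewrite minus_sum in H; lra.
Qed.

Lemma tail_Rabs (x : nat -> R) (N : nat) :
  ex_series (fun m => Rabs (x m)) -> Rabs (tail x N) <= tail (fun m => Rabs (x m)) N.
Proof.
intros Ha; assert (Hx := ex_series_Rabs x Ha).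
apply Rabs_le; split.
- assert (H : tail (fun m => - x m) N <= tail (fun m => Rabs (x m)) N).
  { apply tail_le; [exact (ex_series_opp _ Hx)|exact Ha|].
    intros j _; rewrite <- Rabs_Ropp; apply Rle_abs. }
  assert (E : tail (fun m => - x m) N = - tail x N).
  { unfold tail; rewrite Series_opp.
    replace (sum_f_R0 (fun m => - x m) N) with (- 1 * sum_f_R0 x N).
    - ring.
    - rewrite scal_sum; apply sum_eq; intros; ring. }
  lra.
- apply tail_le; [exact Hx|exact Ha|intros; apply Rle_abs].
Qed.

(** With [X] the generating function of [x], the sums over [j > m] have generating function
    [(X(1) - X(z)) / (1 - z)]. *)
Lemma tail_conv (x : nat -> R) :
  conv (seq_sub dirac0 (delta 1)) (tail x) = seq_sub (seq_cst (Series x)) x.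
Proof.
replace (conv (seq_sub dirac0 (delta 1)) (tail x))
  with (seq_sub (tail x) (conv (delta 1) (tail x))) by ring.
apply functional_extensionality; intros [|m]; unfold seq_sub, seq_cst, scal_seq;
  rewrite conv_delta; simpl; unfold tail; simpl; [ring|].
rewrite Nat.sub_0_r; ring.
Qed.

(** Abel summation, with [Y] the discrete primitive of [y] and the boundary term kept explicit. *)
Lemma sum_tail (x y Y : nat -> R) (N : nat) :
  Y 0%nat = 0 -> (forall m, Y (S m) = Y m + y m) ->
  sum_f_R0 (fun m => y m * tail x m) N
  = sum_f_R0 (fun m => Y m * x m) N + Y (S N) * tail x N.
Proof.
intros HY0 HY; induction N as [|N IH].
- simpl; rewrite HY, HY0; ring.
- simpl; rewrite IH, (HY (S N)); unfold tail; simpl; ring.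
Qed.

(** Disposes of the boundary term of Abel summation, since [Y j >= Y (S N)] for [j > N]. *)
Lemma weighted_tail_le (x Y : nat -> R) (N : nat) :
  (forall m, 0 <= x m) -> (forall m n, (m <= n)%nat -> Y m <= Y n) ->
  ex_series x -> ex_series (fun m => Y m * x m) ->
  Y (S N) * tail x N <= tail (fun m => Y m * x m) N.
Proof.
intros Hx HY He HeY.
assert (E : Y (S N) * tail x N = tail (fun m => Y (S N) * x m) N).
{ unfold tail; rewrite Series_scal_l, Rmult_minus_distr_l; f_equal.
  rewrite scal_sum; apply sum_eq; intros; ring. }
rewrite E; apply tail_le; [exact (ex_series_scal _ _ He)|exact HeY|].
intros j Hj; apply Rmult_le_compat_r; [apply Hx|apply HY; lia].
Qed.

(** Used with [y = 1], [Y = m] and with [y = m], [Y = m (m - 1) / 2]; the second pair is the origin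
    of the weights [l (l - 1) / 2]. *)
Lemma sum_tail_le (x y Y : nat -> R) (N : nat) :
  Y 0%nat = 0 -> (forall m, Y (S m) = Y m + y m) ->
  (forall m, 0 <= x m) -> (forall m, 0 <= y m) ->
  ex_series x -> ex_series (fun m => Y m * x m) ->
  sum_f_R0 (fun m => y m * tail x m) N <= Series (fun m => Y m * x m).
Proof.
intros HY0 HY Hx Hy He HeY.
rewrite (sum_tail x y Y N HY0 HY).
assert (Hmono : forall m n, (m <= n)%nat -> Y m <= Y n).
{ intros m n H; induction H; [lra|]; rewrite HY; specialize (Hy m0); lra. }
generalize (weighted_tail_le x Y N Hx Hmono He HeY); unfold tail at 2; lra.
Qed.

(** The formula [E X = sum P(X > m)] for signed sequences; the boundary term is dominated by the
    tail of the convergent series of [m |x m|]. *)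
Lemma is_series_tail (x : nat -> R) :
  ex_series (fun m => Rabs (x m)) -> ex_series (fun m => INR m * Rabs (x m)) ->
  is_series (tail x) (Series (seq_euler x)).
Proof.
intros Hx Hex; apply is_series_lim.
apply is_lim_seq_ext with (u := fun N => sum_f_R0 (seq_euler x) N + INR (S N) * tail x N).
{ intros N; unfold seq_euler; rewrite <- (sum_tail x (fun _ => 1) INR N); [|reflexivity|apply S_INR].
  apply sum_eq; intros; ring. }
rewrite <- (Rplus_0_r (Series (seq_euler x))); apply is_lim_seq_plus'.
- apply Series_lim, ex_series_Rabs.
  apply ex_series_ext with (2 := Hex); intros m; unfold seq_euler.
  rewrite Rabs_mult, (Rabs_pos_eq (INR m)) by apply pos_INR; reflexivity.
- apply is_lim_seq_abs_0.
  apply is_lim_seq_le_le with (u := fun _ => 0) (w := tail (fun m => INR m * Rabs (x m))).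
  + intros N; split; [apply Rabs_pos|].
    rewrite Rabs_mult, (Rabs_pos_eq (INR (S N))) by apply pos_INR.
    eapply Rle_trans.
    * apply Rmult_le_compat_l; [apply pos_INR|apply tail_Rabs, Hx].
    * apply weighted_tail_le; try assumption.
      -- intros; apply Rabs_pos.
      -- intros; apply le_INR; assumption.
  + apply is_lim_seq_const.
  + apply tail_lim, Hex.
Qed.

(* Second-order Taylor expansion of a generating function at 1: a double zero can be factored
   out, and the cofactor is the double tail of the coefficients. *)
Lemma second_order_factor (c : nat -> R) (s : R) :
  abs_sum c s -> abs_sum (seq_euler c) 0 ->
  ex_series (fun l => INR l * (INR l - 1) / 2 * Rabs (c l)) ->
  exists K, l1_le K (Series (fun l => INR l * (INR l - 1) / 2 * Rabs (c l))) /\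
    seq_sub c (seq_cst s)
    = conv (seq_sub dirac0 (delta 1)) (conv (seq_sub dirac0 (delta 1)) K).
Proof.
intros [Hc Hcs] [Hd Hds] Hw.
assert (Hd' : ex_series (fun m => INR m * Rabs (c m))).
{ apply ex_series_ext with (2 := Hd); intros m; unfold seq_euler.
  rewrite Rabs_mult, (Rabs_pos_eq (INR m)) by apply pos_INR; reflexivity. }
set (x := tail (fun m => Rabs (c m))).
assert (Hx0 : forall m, 0 <= x m).
{ intros m; apply tail_nonneg; [exact Hc|intros; apply Rabs_pos]. }
assert (Hxm0 : forall m, 0 <= INR m * x m).
{ intros m; apply Rmult_le_pos; [apply pos_INR|apply Hx0]. }
assert (Hx : ex_series x).
{ apply ex_series_bounded with (Series (fun m => INR m * Rabs (c m))); [exact Hx0|].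
  intros N; apply Rle_trans with (sum_f_R0 (fun m => 1 * x m) N);
    [right; apply sum_eq; intros; ring|].
  apply (sum_tail_le _ (fun _ => 1) INR); try assumption; try reflexivity.
  - apply S_INR.
  - intros; apply Rabs_pos.
  - intros; lra. }
assert (Hxb : forall N, sum_f_R0 (fun m => INR m * x m) N
  <= Series (fun l => INR l * (INR l - 1) / 2 * Rabs (c l))).
{ intros N; apply (sum_tail_le _ INR (fun l => INR l * (INR l - 1) / 2)); try assumption.
  - simpl; lra.
  - intros m; rewrite S_INR; lra.
  - intros; apply Rabs_pos.
  - apply pos_INR. }
assert (Hxm : ex_series (fun m => INR m * x m)) by (eapply ex_series_bounded; eauto).
assert (Htc : forall m, Rabs (tail c m) <= x m) by (intros; apply tail_Rabs, Hc).
assert (Hta : ex_series (fun m => Rabs (tail c m))).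
{ apply (ex_series_le (fun m => Rabs (tail c m)) x); [|exact Hx].
  intros m; unfold norm; simpl; unfold abs; simpl; rewrite Rabs_Rabsolu; apply Htc. }
exists (tail (tail c)); split.
- intros N; apply Rle_trans with (sum_f_R0 (fun m => 1 * tail x m) N).
  + apply sum_Rle; intros m _; rewrite Rmult_1_l.
    eapply Rle_trans; [apply tail_Rabs, Hta|apply tail_le; auto].
  + apply Rle_trans with (Series (fun m => INR m * x m)).
    * apply (sum_tail_le _ (fun _ => 1) INR); try assumption; try reflexivity.
      -- apply S_INR.
      -- intros; lra.
    * apply Series_le_bound; assumption.
(* The vanishing first moment removes the constant term of the second factorization, and the two
   sign changes cancel. *)
- assert (E0 : Series (tail c) = 0).
  { rewrite (is_series_unique _ _ (is_series_tail c Hc Hd')); apply is_series_unique, Hds. }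
  rewrite (tail_conv (tail c)), E0.
  replace (seq_cst 0) with seq_zero
    by (apply functional_extensionality; intros m; unfold seq_cst, scal_seq, seq_zero; ring).
  replace (conv (seq_sub dirac0 (delta 1)) (seq_sub seq_zero (tail c)))
    with (seq_opp (conv (seq_sub dirac0 (delta 1)) (tail c))) by ring.
  rewrite (tail_conv c), (is_series_unique c s Hcs); ring.
Qed.

(** * The negative binomial law *)

Lemma gbinom_pos (alpha : R) (m : nat) : 0 < alpha -> 0 < gbinom alpha m.
Proof.
intros Ha; induction m as [|m IH]; cbn [gbinom]; [lra|].
assert (H0 := pos_INR m).
apply Rdiv_lt_0_compat; [|apply lt_0_INR; lia].
apply Rmult_lt_0_compat; lra.
Qed.

Lemma gbinom_S (alpha : R) (m : nat) :
  INR (S m) * gbinom alpha (S m) = (alpha + INR m) * gbinom alpha m.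
Proof. cbn [gbinom]; field; apply not_0_INR; lia. Qed.

Lemma nb_pmf_pos (alpha p : R) (m : nat) : 0 < alpha -> 0 < p < 1 -> 0 < nb_pmf alpha p m.
Proof.
intros Ha Hp; unfold nb_pmf; repeat apply Rmult_lt_0_compat.
- apply gbinom_pos, Ha.
- unfold Rpower; apply exp_pos.
- apply pow_lt; lra.
Qed.

Lemma nb_pmf_S (alpha p : R) (m : nat) :
  INR (S m) * nb_pmf alpha p (S m) = (1 - p) * (alpha + INR m) * nb_pmf alpha p m.
Proof.
unfold nb_pmf; rewrite <- tech_pow_Rmult.
replace (INR (S m) * _) with (INR (S m) * gbinom alpha (S m) * Rpower p alpha * ((1 - p) * (1 - p) ^ m))
  by ring.
rewrite gbinom_S; ring.
Qed.

Lemma gbinom_CV_radius (alpha : R) : 0 < alpha -> CV_radius (gbinom alpha) = 1.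
Proof.
intros Ha; replace (Finite 1) with (Finite (/ 1)) by (f_equal; field).
apply CV_radius_finite_DAlembert; [|lra|].
- intros m; apply Rgt_not_eq, gbinom_pos, Ha.
- apply is_lim_seq_ext with (u := fun m => 1 + (alpha - 1) * / INR (S m)).
  + intros m; assert (H := gbinom_pos alpha m Ha); assert (H' := pos_INR m).
    cbn [gbinom]; rewrite Rabs_pos_eq.
    * rewrite S_INR; field; lra.
    * rewrite S_INR; apply Rlt_le, Rdiv_lt_0_compat; [|exact H].
      apply Rdiv_lt_0_compat; [apply Rmult_lt_0_compat|]; lra.
  + replace (Finite 1) with (Finite (1 + (alpha - 1) * 0)) by (f_equal; ring).
    apply is_lim_seq_plus'; [apply is_lim_seq_const|].
    apply is_lim_seq_mult'; [apply is_lim_seq_const|].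
    apply (is_lim_seq_incr_1 (fun m => / INR m) 0).
    apply (is_lim_seq_inv INR p_infty); [apply is_lim_seq_INR|discriminate].
Qed.

(* The binomial series: [S(x) (1 - x)^alpha] has zero derivative because [(1 - x) S' = alpha S]. *)
Lemma gbinom_series (alpha q : R) :
  0 < alpha -> 0 < q < 1 -> is_series (fun m => gbinom alpha m * q ^ m) (Rpower (1 - q) (- alpha)).
Proof.
intros Ha Hq.
assert (Hcv : forall x, 0 <= x <= q -> Rbar_lt (Rabs x) (CV_radius (gbinom alpha))).
{ intros x Hx; rewrite gbinom_CV_radius by exact Ha; simpl; rewrite Rabs_pos_eq; lra. }
set (y := fun x => PSeries (gbinom alpha) x * exp (alpha * ln (1 - x))).
assert (Hode : forall x, 0 <= x <= q ->
  (1 - x) * PSeries (PS_derive (gbinom alpha)) x = alpha * PSeries (gbinom alpha) x).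
{ intros x Hx.
  assert (He : ex_pseries (gbinom alpha) x)
    by (apply CV_radius_inside, Hcv, Hx).
  assert (Hd : ex_pseries (PS_derive (gbinom alpha)) x).
  { apply CV_radius_inside; rewrite CV_radius_derive; apply Hcv, Hx. }
  rewrite Rmult_minus_distr_r, Rmult_1_l, <- PSeries_incr_1, <- PSeries_scal.
  rewrite <- PSeries_minus; [|exact Hd|apply (ex_pseries_incr_1 _ x Hd)].
  apply PSeries_ext; intros m; unfold PS_minus, PS_plus, PS_opp, PS_scal, plus, opp, scal; simpl.
  unfold mult; simpl.
  assert (E := gbinom_S alpha m); unfold PS_derive; rewrite E.
  destruct m as [|m]; [simpl PS_incr_1; unfold zero; simpl; ring|].
  change (PS_incr_1 (fun n => INR (S n) * gbinom alpha (S n)) (S m))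
    with (INR (S m) * gbinom alpha (S m)); ring. }
assert (E : y 0 = y q).
{ apply (eq_is_derive y 0 q); [|lra].
  intros x Hx; unfold y.
  evar_last.
  - apply @is_derive_mult.
    + apply is_derive_PSeries, Hcv, Hx.
    + instantiate (1 := exp (alpha * ln (1 - x)) * (alpha * (- 1 / (1 - x)))).
      auto_derive; [lra|]. unfold Rminus. field; lra.
    + intros; apply Rmult_comm.
  - unfold plus, mult, zero; simpl.
    replace (PSeries (PS_derive (gbinom alpha)) x)
      with (alpha * PSeries (gbinom alpha) x / (1 - x)); [field; lra|].
    rewrite <- Hode by exact Hx; field; lra. }
unfold y in E; rewrite PSeries_0 in E; cbn [gbinom] in E.
rewrite Rminus_0_r, ln_1, Rmult_0_r, exp_0, Rmult_1_l in E.
assert (Ev : PSeries (gbinom alpha) q = Rpower (1 - q) (- alpha)).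
{ unfold Rpower; apply Rmult_eq_reg_r with (exp (alpha * ln (1 - q))).
  - rewrite <- E, <- exp_plus.
    replace (- alpha * ln (1 - q) + alpha * ln (1 - q)) with 0 by ring; rewrite exp_0; reflexivity.
  - apply Rgt_not_eq, exp_pos. }
rewrite <- Ev; apply Series_correct, ex_series_Rabs, CV_disk_inside, Hcv; lra.
Qed.

Lemma nb_pmf_series (alpha p : R) :
  0 < alpha -> 0 < p < 1 -> is_series (nb_pmf alpha p) 1.
Proof.
intros Ha Hp.
replace (nb_pmf alpha p) with (scal_seq (Rpower p alpha) (fun m => gbinom alpha m * (1 - p) ^ m)).
- assert (E : Rpower p alpha * Rpower (1 - (1 - p)) (- alpha) = 1).
  { replace (1 - (1 - p)) with p by ring.
    rewrite <- Rpower_plus, Rplus_opp_r; apply Rpower_O; lra. }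
  assert (H := is_series_scal_seq (Rpower p alpha) _ _ (gbinom_series alpha (1 - p) Ha ltac:(lra))).
  rewrite E in H; exact H.
- apply functional_extensionality; intros m; unfold scal_seq, nb_pmf; ring.
Qed.

(** Here [L], [s], [U] are the masses below, at and above a point, and the increment is linear in
    the integrals [A], [s h], [B] of the test function over these three ranges. The last two
    hypotheses fix the signs: [A] and [B] enter with nonpositive coefficients, [h] with a
    nonnegative one. So the indicator of the point, lowered by 1/2, is extremal; it yields
    [(r L + m U) / (r m)], which is at most [1 / r] because [r L <= m (L + s)]. *)
Lemma stein_increment_bound (L s U r m A B h : R) :
  0 <= L -> 0 < s -> 0 <= U -> L + s + U = 1 -> 0 < r -> 0 < m ->
  Rabs A <= L / 2 -> Rabs B <= U / 2 -> Rabs h <= 1 / 2 ->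
  r * L <= m * (L + s) -> m * U <= r * (s + U) ->
  let mu := A + s * h + B in
  Rabs ((A + s * h - mu * (L + s)) / (r * s) - (A - mu * L) / (m * s)) <= 1 / r.
Proof.
intros HL Hs HU H1 Hr Hm HA HB Hh HrL HmU mu.
assert (Hsm : 0 < s * m) by (apply Rmult_lt_0_compat; assumption).
assert (Hrsm : 0 < r * (s * m)) by (apply Rmult_lt_0_compat; assumption).
replace (_ - _)
  with ((A * (m * U - r * (s + U)) + h * (s * (m * U + r * L)) + B * (r * L - m * (L + s)))
        / (r * (s * m))).
2:{ unfold mu; replace U with (1 - L - s) by lra; field; lra. }
unfold Rdiv at 1; rewrite Rabs_mult, (Rabs_pos_eq (/ _)) by (apply Rlt_le, Rinv_0_lt_compat, Hrsm).
apply Rmult_le_reg_r with (r * (s * m)); [exact Hrsm|].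
rewrite Rmult_assoc, Rinv_l, Rmult_1_r by lra.
replace (1 / r * (r * (s * m))) with (s * m) by (field; lra).
assert (HsU : 0 <= s * (m * U + r * L)).
{ apply Rmult_le_pos; [lra|]; apply Rplus_le_le_0_compat; apply Rmult_le_pos; lra. }
eapply Rle_trans; [apply Rabs_triang|].
eapply Rle_trans; [apply Rplus_le_compat_r, Rabs_triang|].
rewrite !Rabs_mult, (Rabs_left1 (m * U - _)), (Rabs_left1 (r * L - _)),
  (Rabs_pos_eq s), (Rabs_pos_eq (m * U + _)) by nra.
apply Rle_trans with (L / 2 * - (m * U - r * (s + U)) + 1 / 2 * (s * (m * U + r * L))
  + U / 2 * - (r * L - m * (L + s))).
- repeat apply Rplus_le_compat; apply Rmult_le_compat_r; lra.
- replace (_ + _ + _) with (s * (r * L + m * U)) by field.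
  apply Rmult_le_compat_l; [lra|]; replace m with (m * (L + s + U)) at 2 by (rewrite H1; ring); lra.
Qed.

(* Detailed balance turns both monotonicity properties of the partial and tail sums of the negative
   binomial law into elementary inductions, using only [q <= 1]. *)
Lemma nb_sum_mono (alpha q : R) (w : nat -> R) (m : nat) :
  q <= 1 -> (forall i, 0 < w i) ->
  (forall i, INR (S i) * w (S i) = q * (alpha + INR i) * w i) ->
  q * (alpha + INR (S m)) * sum_f_R0 w m <= INR (S m) * sum_f_R0 w (S m).
Proof.
intros Hq Hw Hrec.
assert (Hs : forall N, 0 < sum_f_R0 w N).
{ induction N as [|N IH]; simpl; [apply Hw|]; specialize (Hw (S N)); lra. }
induction m as [|m IH].
- generalize (Hrec 0%nat), (Hw 0%nat); simpl; nra.
- change (sum_f_R0 w (S (S m))) with (sum_f_R0 w (S m) + w (S (S m))).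
  rewrite (Rmult_plus_distr_l (INR (S (S m)))), Hrec.
  assert (Hp := Hs (S m)).
  rewrite (S_INR (S m)).
  change (sum_f_R0 w (S m)) with (sum_f_R0 w m + w (S m)) in *.
  nra.
Qed.

Lemma nb_partial_tail_mono (alpha q : R) (w : nat -> R) (m n : nat) :
  q <= 1 -> (forall i, 0 < w i) ->
  (forall i, INR (S i) * w (S i) = q * (alpha + INR i) * w i) ->
  INR m * (sum_f_R0 w (m + n) - sum_f_R0 w m) + INR (S (m + n)) * w (S (m + n))
  <= q * (alpha + INR m) * (w m + (sum_f_R0 w (m + n) - sum_f_R0 w m)).
Proof.
intros Hq Hw Hrec; induction n as [|n IH].
- rewrite Nat.add_0_r, Hrec; lra.
- rewrite Nat.add_succ_r, (Hrec (S (m + n))).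
  change (sum_f_R0 w (S (m + n))) with (sum_f_R0 w (m + n) + w (S (m + n))).
  assert (Hp := Hw (S (m + n))).
  assert (E : INR (S (m + n)) = INR m + (INR n + 1)) by (rewrite S_INR, plus_INR; ring).
  assert (Hn := pos_INR n); rewrite E in IH |- *.
  assert (0 <= (1 - q) * (INR n + 1) * w (S (m + n))) by (repeat apply Rmult_le_pos; lra).
  lra.
Qed.

Lemma nb_tail_mono (alpha q : R) (w : nat -> R) (m : nat) :
  q <= 1 -> (forall i, 0 < w i) ->
  (forall i, INR (S i) * w (S i) = q * (alpha + INR i) * w i) -> ex_series w ->
  INR m * tail w m <= q * (alpha + INR m) * (w m + tail w m).
Proof.
intros Hq Hw Hrec He; unfold tail.
assert (Hl : is_lim_seq (fun n => sum_f_R0 w (m + n) - sum_f_R0 w m) (Series w - sum_f_R0 w m)).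
{ apply is_lim_seq_minus'; [|apply is_lim_seq_const].
  apply is_lim_seq_ext with (fun n => sum_f_R0 w (n + m)).
  - intros n; f_equal; lia.
  - apply (is_lim_seq_incr_n (sum_f_R0 w) m), Series_lim, He. }
refine (is_lim_seq_le _ _ (Finite _) (Finite _) _
  (is_lim_seq_scal_l _ (INR m) _ Hl)
  (is_lim_seq_scal_l _ (q * (alpha + INR m)) _ (is_lim_seq_plus' _ _ _ _ (is_lim_seq_const (w m)) Hl))).
intros n; generalize (nb_partial_tail_mono alpha q w m n Hq Hw Hrec).
assert (0 <= INR (S (m + n)) * w (S (m + n))).
{ apply Rmult_le_pos; [apply pos_INR|apply Rlt_le, Hw]. }
lra.
Qed.

(** * The Stein equation of the negative binomial law *)

Lemma Rabs_sum_half (w h : nat -> R) (N : nat) :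
  (forall i, 0 < w i) -> (forall i, Rabs (h i) <= 1 / 2) ->
  Rabs (sum_f_R0 (fun i => w i * h i) N) <= sum_f_R0 w N / 2.
Proof.
intros Hw Hh; eapply Rle_trans; [apply Rsum_abs|].
unfold Rdiv; rewrite Rmult_comm, scal_sum; apply sum_Rle; intros i _.
rewrite Rabs_mult, (Rabs_pos_eq (w i)) by (apply Rlt_le, Hw).
specialize (Hw i); specialize (Hh i).
apply Rmult_le_compat_l; lra.
Qed.

Lemma tail_half (w h : nat -> R) (N : nat) :
  (forall i, 0 < w i) -> (forall i, Rabs (h i) <= 1 / 2) -> ex_series w ->
  ex_series (fun i => w i * h i) /\ Rabs (tail (fun i => w i * h i) N) <= tail w N / 2.
Proof.
intros Hw Hh He.
assert (Hle : forall i, Rabs (w i * h i) <= w i * / 2).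
{ intros i; rewrite Rabs_mult, (Rabs_pos_eq (w i)) by (apply Rlt_le, Hw).
  specialize (Hw i); specialize (Hh i); apply Rmult_le_compat_l; lra. }
assert (He2 : ex_series (fun i => w i * / 2)) by (apply ex_series_scal_r, He).
assert (Ha : ex_series (fun i => Rabs (w i * h i))).
{ apply (ex_series_le (fun i => Rabs (w i * h i)) (fun i => w i * / 2)); [|exact He2].
  intros i; unfold norm; simpl; unfold abs; simpl; rewrite Rabs_Rabsolu; apply Hle. }
split; [apply ex_series_Rabs, Ha|].
eapply Rle_trans; [apply tail_Rabs, Ha|].
eapply Rle_trans; [apply (tail_le _ (fun i => w i * / 2)); auto|].
right; unfold tail; rewrite Series_scal_r.
rewrite <- scal_sum; unfold Rdiv; ring.
Qed.

(* The solution of the Stein equation [q (alpha + m) x m - m x (m - 1) = h m - mu]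
   for the law [w], indexed so that [x m] is the usual [g (m + 1)]. *)
Definition stein_sol (w h : nat -> R) (m : nat) : R :=
  sum_f_R0 (fun i => w i * (h i - Series (fun j => w j * h j))) m / (INR (S m) * w (S m)).

Lemma stein_num (w h : nat -> R) (m : nat) :
  sum_f_R0 (fun i => w i * (h i - Series (fun j => w j * h j))) m
  = sum_f_R0 (fun i => w i * h i) m - Series (fun j => w j * h j) * sum_f_R0 w m.
Proof.
rewrite (Rmult_comm (Series _)), Rmult_comm, scal_sum, <- minus_sum.
apply sum_eq; intros; ring.
Qed.

Lemma stein_sol_increment (alpha q : R) (w h : nat -> R) (m : nat) :
  0 < alpha -> 0 < q <= 1 -> (forall i, 0 < w i) ->
  (forall i, INR (S i) * w (S i) = q * (alpha + INR i) * w i) -> is_series w 1 ->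
  (forall i, Rabs (h i) <= 1 / 2) ->
  Rabs (stein_sol w h (S m) - stein_sol w h m) <= / (alpha * q).
Proof.
intros Ha Hq Hw Hrec H1 Hh.
assert (He : ex_series w) by (exists 1; exact H1).
assert (Hm := pos_INR m).
assert (Hm1 : 0 < INR (S m)) by (apply lt_0_INR; lia).
assert (Hr : 0 < q * (alpha + INR (S m))) by (apply Rmult_lt_0_compat; lra).
destruct (tail_half w h (S m) Hw Hh He) as [Hwh HB].
assert (Hsum1 : sum_f_R0 w m + w (S m) + tail w (S m) = 1).
{ unfold tail; rewrite (is_series_unique w 1 H1); simpl; ring. }
unfold stein_sol; rewrite !stein_num, (Hrec (S m)).
assert (Hmu : Series (fun j => w j * h j) = sum_f_R0 (fun i => w i * h i) m
  + w (S m) * h (S m) + tail (fun i => w i * h i) (S m)) by (unfold tail; simpl; ring).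
change (sum_f_R0 w (S m)) with (sum_f_R0 w m + w (S m)).
change (sum_f_R0 (fun i => w i * h i) (S m))
  with (sum_f_R0 (fun i => w i * h i) m + w (S m) * h (S m)).
rewrite Hmu.
apply Rle_trans with (1 / (q * (alpha + INR (S m)))).
- apply stein_increment_bound with (U := tail w (S m)); try assumption.
  + apply Rlt_le; clear - Hw; induction m as [|m IH]; simpl; [apply Hw|].
    specialize (Hw (S m)); lra.
  + apply Hw.
  + apply tail_nonneg; [exact He|intros; apply Rlt_le, Hw].
  + apply Rabs_sum_half; assumption.
  + apply Hh.
  + apply (nb_sum_mono alpha q w m); try assumption; lra.
  + apply (nb_tail_mono alpha q w (S m)); try assumption; lra.
- unfold Rdiv; rewrite Rmult_1_l; apply Rinv_le_contravar.
  + apply Rmult_lt_0_compat; lra.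
  + nra.
Qed.

(** Serves to make boundary terms vanish. The numerator is at most [tail w m] in absolute value, and
    [tail w m / (INR (S m) * w (S m))] is nonincreasing by [nb_tail_mono], hence at most its value
    at 0. *)
Lemma stein_sol_bounded (alpha q : R) (w h : nat -> R) (m : nat) :
  0 < alpha -> 0 < q <= 1 -> (forall i, 0 < w i) ->
  (forall i, INR (S i) * w (S i) = q * (alpha + INR i) * w i) -> is_series w 1 ->
  (forall i, Rabs (h i) <= 1 / 2) ->
  Rabs (stein_sol w h m) <= tail w 0 / w 1%nat.
Proof.
intros Ha Hq Hw Hrec H1 Hh.
assert (He : ex_series w) by (exists 1; exact H1).
assert (Ht : forall N, 0 <= tail w N)
  by (intros; apply tail_nonneg; [exact He|intros; apply Rlt_le, Hw]).
assert (Hmw : forall i, 0 < INR (S i) * w (S i)).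
{ intros i; apply Rmult_lt_0_compat; [apply lt_0_INR; lia|apply Hw]. }
apply Rle_trans with (tail w m / (INR (S m) * w (S m))).
- unfold stein_sol, Rdiv; rewrite Rabs_mult, (Rabs_pos_eq (/ _))
    by (apply Rlt_le, Rinv_0_lt_compat, Hmw).
  apply Rmult_le_compat_r; [apply Rlt_le, Rinv_0_lt_compat, Hmw|].
  rewrite stein_num.
  destruct (tail_half w h m Hw Hh He) as [Hwh HB].
  assert (HA := Rabs_sum_half w h m Hw Hh).
  set (A := sum_f_R0 (fun i => w i * h i) m) in *.
  set (L := sum_f_R0 w m) in *.
  assert (HU : tail w m = 1 - L) by (unfold tail; rewrite (is_series_unique w 1 H1); reflexivity).
  assert (Hmu : Series (fun j => w j * h j) = A + tail (fun i => w i * h i) m)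
    by (unfold tail, A; ring).
  rewrite Hmu; set (B := tail (fun i => w i * h i) m) in *.
  assert (HL : 0 <= L) by (generalize (Rabs_pos A); lra).
  specialize (Ht m).
  replace (A - (A + B) * L) with (A * tail w m + - (B * L)) by (rewrite HU; ring).
  eapply Rle_trans; [apply Rabs_triang|].
  rewrite Rabs_Ropp, !Rabs_mult, (Rabs_pos_eq L), (Rabs_pos_eq (tail w m)) by assumption.
  apply Rle_trans with (L / 2 * tail w m + tail w m / 2 * L).
  + apply Rplus_le_compat; apply Rmult_le_compat_r; assumption.
  + nra.
- induction m as [|m IH]; [right; simpl; field; apply Rgt_not_eq, Hw|].
  eapply Rle_trans; [|apply IH].
  assert (HM := nb_tail_mono alpha q w (S m) (proj2 Hq) Hw Hrec He).
  assert (E : w (S m) + tail w (S m) = tail w m) by (unfold tail; simpl; ring).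
  rewrite E in HM; rewrite (Hrec (S m)).
  assert (Hm1 : 0 < INR (S m)) by (apply lt_0_INR; lia).
  assert (Hr : 0 < q * (alpha + INR (S m))) by (apply Rmult_lt_0_compat; lra).
  specialize (Hw (S m)); set (r := q * (alpha + INR (S m))) in *.
  apply Rmult_le_reg_r with (r * INR (S m) * w (S m)); [apply Rmult_lt_0_compat; [apply Rmult_lt_0_compat|]; assumption|].
  replace (tail w (S m) / (r * w (S m)) * (r * INR (S m) * w (S m)))
    with (INR (S m) * tail w (S m)) by (field; split; apply Rgt_not_eq; assumption).
  replace (tail w m / (INR (S m) * w (S m)) * (r * INR (S m) * w (S m)))
    with (r * tail w m) by (field; split; apply Rgt_not_eq; assumption).
  exact HM.
Qed.

Lemma stein_sol_eq (alpha q : R) (w h : nat -> R) (m : nat) :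
  0 < alpha -> 0 < q -> (forall i, 0 < w i) ->
  (forall i, INR (S i) * w (S i) = q * (alpha + INR i) * w i) ->
  h (S m) - Series (fun j => w j * h j)
  = q * (alpha + INR (S m)) * stein_sol w h (S m) - INR (S m) * stein_sol w h m.
Proof.
intros Ha Hq Hw Hrec; unfold stein_sol; rewrite (Hrec (S m)).
assert (Hm1 : 0 < INR (S m)) by (apply lt_0_INR; lia).
specialize (Hw (S m)).
cbn [sum_f_R0]; field; repeat split; apply Rgt_not_eq; lra.
Qed.

Lemma stein_sol_eq_0 (alpha q : R) (w h : nat -> R) :
  0 < alpha -> 0 < q -> (forall i, 0 < w i) ->
  (forall i, INR (S i) * w (S i) = q * (alpha + INR i) * w i) ->
  h 0%nat - Series (fun j => w j * h j) = q * alpha * stein_sol w h 0.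
Proof.
intros Ha Hq Hw Hrec; unfold stein_sol; rewrite (Hrec 0%nat).
specialize (Hw 0%nat).
cbn [sum_f_R0]; simpl (INR 0); field; repeat split; apply Rgt_not_eq; lra.
Qed.

(* Summation by parts moves the difference operator in the perturbation of the recursion onto the
   Stein solution, whose increments are at most [1 / (alpha q)]. *)
Lemma nb_stein_bound (alpha p s : R) (t F : nat -> R) :
  0 < alpha -> 0 < p < 1 ->
  (forall m, 0 <= t m) -> is_series t 1 -> ex_series (seq_euler t) -> l1_le F s ->
  (forall m, seq_deriv t m
    = (1 - p) * (alpha + INR m) * t m + conv (seq_sub dirac0 (delta 1)) F m) ->
  dTV t (nb_pmf alpha p) <= s / (alpha * (1 - p)).
Proof.
intros Ha Hp Ht Ht1 Htm HF Hrec.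
set (w := nb_pmf alpha p); set (q := 1 - p) in *.
assert (Hq : 0 < q <= 1) by (unfold q; lra).
assert (Hw : forall i, 0 < w i) by (intros; apply nb_pmf_pos; lra).
assert (Hwrec : forall i, INR (S i) * w (S i) = q * (alpha + INR i) * w i)
  by (intros; apply nb_pmf_S).
assert (Hw1 : is_series w 1) by (apply nb_pmf_series; lra).
(* Half the sign of [t - w]: the sum of [h (t - w)] is then exactly the total variation distance. *)
set (h := fun m => if Rle_dec (w m) (t m) then 1 / 2 else - (1 / 2)).
assert (Hh : forall i, Rabs (h i) <= 1 / 2).
{ intros i; unfold h; destruct (Rle_dec (w i) (t i));
    [rewrite Rabs_pos_eq|rewrite Rabs_Ropp, Rabs_pos_eq]; lra. }
assert (Hh' : forall i, h i * (t i - w i) = / 2 * Rabs (t i - w i)).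
{ intros i; unfold h; destruct (Rle_dec (w i) (t i));
    [rewrite Rabs_pos_eq by lra|rewrite Rabs_left1 by lra]; field. }
set (mu := Series (fun j => w j * h j)).
set (x := stein_sol w h).
assert (HC : forall m, Rabs (x m) <= tail w 0 / w 1%nat)
  by (intros; apply stein_sol_bounded with alpha q; assumption).
set (C := tail w 0 / w 1%nat) in *.
assert (HA : forall N, sum_f_R0 (fun m => t m * (h m - mu)) N
  = sum_f_R0 (fun m => F m * (x (S m) - x m)) N - F N * x (S N) + seq_deriv t N * x N).
{ induction N as [|N IH].
  - cbn [sum_f_R0]; unfold mu; rewrite (stein_sol_eq_0 alpha q w h) by (try assumption; lra).
    fold x; rewrite Hrec, conv_diff_0; simpl (INR 0); ring.
  - cbn [sum_f_R0]; rewrite IH; unfold mu.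
    rewrite (stein_sol_eq alpha q w h) by (try assumption; lra).
    fold x; rewrite (Hrec (S N)), conv_diff_S.
    unfold seq_deriv; ring. }
assert (HFabs : ex_series (fun m => Rabs (F m))) by (apply l1_le_ex_series with s, HF).
(* The boundary terms die out because [F] and [m t_m] are summable while [x] is bounded. *)
assert (Hd0 : is_lim_seq (fun N => Rabs (F N) * C + seq_deriv t N * C) 0).
{ replace 0 with (0 * C + 0 * C) by ring.
  apply is_lim_seq_plus'; apply is_lim_seq_mult'; try apply is_lim_seq_const.
  - apply ex_series_lim_0, HFabs.
  - apply (is_lim_seq_incr_1 (seq_euler t) 0), ex_series_lim_0, Htm. }
assert (Hb : forall N, sum_f_R0 (fun m => t m * (h m - mu)) N
  <= s / (alpha * q) + (Rabs (F N) * C + seq_deriv t N * C)).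
{ intros N; rewrite HA.
  assert (Hi : 0 < / (alpha * q)) by (apply Rinv_0_lt_compat, Rmult_lt_0_compat; lra).
  assert (B1 : sum_f_R0 (fun m => F m * (x (S m) - x m)) N <= s / (alpha * q)).
  { apply Rle_trans with (/ (alpha * q) * sum_f_R0 (fun m => Rabs (F m)) N).
    - rewrite scal_sum; apply sum_Rle; intros m _.
      eapply Rle_trans; [apply Rle_abs|]; rewrite Rabs_mult.
      apply Rmult_le_compat_l; [apply Rabs_pos|].
      apply stein_sol_increment; assumption.
    - unfold Rdiv; rewrite Rmult_comm; apply Rmult_le_compat_r; [lra|apply HF]. }
  assert (B2 : - (F N * x (S N)) <= Rabs (F N) * C).
  { eapply Rle_trans; [apply Rle_abs|]; rewrite Rabs_Ropp, Rabs_mult.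
    apply Rmult_le_compat_l; [apply Rabs_pos|apply HC]. }
  assert (B3 : seq_deriv t N * x N <= seq_deriv t N * C).
  { apply Rmult_le_compat_l.
    - apply Rmult_le_pos; [apply pos_INR|apply Ht].
    - eapply Rle_trans; [apply Rle_abs|apply HC]. }
  lra. }
assert (Het : ex_series (fun m => t m * h m)).
{ apply ex_series_Rabs, (ex_series_le (fun i => Rabs (t i * h i)) t); [|exists 1; exact Ht1].
  intros i; unfold norm; simpl; unfold abs; simpl; rewrite Rabs_Rabsolu, Rabs_mult.
  rewrite (Rabs_pos_eq (t i)) by apply Ht; specialize (Ht i); specialize (Hh i).
  assert (0 <= Rabs (h i)) by apply Rabs_pos; nra. }
assert (Hew : ex_series (fun m => w m * h m)).
{ apply (tail_half w h 0); try assumption; exists 1; exact Hw1. }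
assert (Hlim : is_lim_seq (sum_f_R0 (fun m => t m * (h m - mu))) (dTV t w)).
{ replace (dTV t w) with (Series (fun m => t m * h m) - mu * 1).
  - apply is_lim_seq_ext with
      (fun N => sum_f_R0 (fun m => t m * h m) N - mu * sum_f_R0 t N).
    + intros N; rewrite (scal_sum t), <- minus_sum; apply sum_eq; intros; ring.
    + apply is_lim_seq_minus'; [apply Series_lim, Het|].
      apply is_lim_seq_mult'; [apply is_lim_seq_const|].
      apply is_series_lim, Ht1.
  - unfold mu, dTV; rewrite <- Series_scal_l, Rmult_1_r, <- Series_minus by assumption.
    apply Series_ext; intros m; rewrite <- Hh'; ring. }
replace (s / (alpha * q)) with (s / (alpha * q) + 0) by ring.
refine (is_lim_seq_le _ _ (Finite _) (Finite _) Hb Hlim _).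
apply is_lim_seq_plus'; [apply is_lim_seq_const|exact Hd0].
Qed.

(** * The coefficients of the generating function *)

(* [Binomial.C n l] is a nonzero junk value for [l > n]. *)
Definition choose (n l : nat) : R := if Nat.leb l n then Binomial.C n l else 0.

Lemma choose_0 (n : nat) : choose n 0 = 1.
Proof. unfold choose, Binomial.C; simpl; rewrite Nat.sub_0_r; field; apply INR_fact_neq_0. Qed.

Lemma choose_gt (n l : nat) : (n < l)%nat -> choose n l = 0.
Proof. intros H; unfold choose; destruct (Nat.leb_spec l n); [lia|reflexivity]. Qed.

Lemma choose_diag (n : nat) : choose n n = 1.
Proof.
unfold choose; rewrite Nat.leb_refl; unfold Binomial.C; rewrite Nat.sub_diag; simpl.
field; apply INR_fact_neq_0.
Qed.

Lemma choose_SS (n l : nat) : choose (S n) (S l) = choose n l + choose n (S l).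
Proof.
destruct (Nat.lt_trichotomy l n) as [H|[H|H]].
- unfold choose; destruct (Nat.leb_spec (S l) (S n)), (Nat.leb_spec l n), (Nat.leb_spec (S l) n);
    try lia; rewrite <- pascal by exact H; reflexivity.
- subst; rewrite !choose_diag, choose_gt by lia; ring.
- rewrite !choose_gt by lia; ring.
Qed.

(** Past [m / k] the lower index exceeds the upper one, also where the subtraction is truncated to
    0. All sums can therefore be taken over a common range. *)
Lemma b_coef_choose (k : nat) (a : R) (m N : nat) : (1 <= k)%nat -> (m <= N)%nat ->
  b_coef k a m = sum_f_R0 (fun l => (-1) ^ l * choose (m - l * (k - 1)) l * a ^ l) N.
Proof.
intros Hk HN; unfold b_coef.
assert (Hd : (m / k <= m)%nat) by (apply Nat.Div0.div_le_upper_bound; nia).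
set (M := (m / k)%nat) in *.
assert (HM : (k * M <= m /\ m < k * (M + 1))%nat).
{ unfold M; split; [apply Nat.Div0.mul_div_le|].
  rewrite Nat.add_1_r; apply Nat.mul_succ_div_gt; lia. }
transitivity (sum_f_R0 (fun l => (-1) ^ l * choose (m - l * (k - 1)) l * a ^ l) M).
- apply sum_eq; intros l Hl; unfold choose.
  destruct (Nat.leb_spec l (m - l * (k - 1))); [reflexivity|nia].
- replace N with (M + (N - M))%nat by lia.
  induction (N - M)%nat as [|i IH]; [rewrite Nat.add_0_r; reflexivity|].
  rewrite Nat.add_succ_r; cbn [sum_f_R0]; rewrite IH.
  rewrite choose_gt by nia; ring.
Qed.

Lemma b_coef_0 (k : nat) (a : R) : (1 <= k)%nat -> b_coef k a 0 = 1.
Proof. intros Hk; rewrite (b_coef_choose k a 0 0) by lia; simpl; rewrite choose_0; ring. Qed.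

(** Pascal's rule in each summand. *)
Lemma b_coef_S (k : nat) (a : R) (m : nat) : (1 <= k)%nat ->
  b_coef k a (S m) = b_coef k a m - (if Nat.leb k (S m) then a * b_coef k a (S m - k) else 0).
Proof.
intros Hk; rewrite (b_coef_choose k a (S m) (S m)), (b_coef_choose k a m (S m)) by lia.
rewrite !(decomp_sum _ (S m)) by lia; simpl pred.
rewrite !Nat.mul_0_l, !choose_0.
destruct (Nat.leb_spec k (S m)) as [H|H].
- rewrite (b_coef_choose k a (S m - k) m) by lia.
  rewrite scal_sum; unfold Rminus; rewrite Rplus_assoc; f_equal.
  change (?x + - ?y) with (x - y); rewrite <- minus_sum.
  apply sum_eq; intros j Hj.
  (* Pascal's rule applies when no subtraction is truncated; otherwise all three upper indices are
     0, the lower ones are positive, and every term vanishes. *)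
  destruct (Nat.le_gt_cases (S j * (k - 1) + 1) (S m)) as [H1|H1].
  + replace (S m - S j * (k - 1))%nat with (S (m - S j * (k - 1))) by lia.
    replace (S m - k - j * (k - 1))%nat with (m - S j * (k - 1))%nat by nia.
    rewrite choose_SS; simpl pow; ring.
  + replace (S m - S j * (k - 1))%nat with 0%nat by lia.
    replace (m - S j * (k - 1))%nat with 0%nat by lia.
    replace (S m - k - j * (k - 1))%nat with 0%nat by nia.
    rewrite !choose_gt by nia; ring.
- rewrite Rminus_0_r; f_equal; apply sum_eq; intros j Hj.
  rewrite !choose_gt by nia; ring.
Qed.

(* The polynomial [1 - z + a z^k] in the denominator of the generating function. *)
Definition denom_seq (k : nat) (a : R) : nat -> R :=
  seq_add (seq_sub dirac0 (delta 1)) (scal_seq a (delta k)).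

Lemma denom_b_coef (k : nat) (a : R) : (1 <= k)%nat ->
  conv (denom_seq k a) (b_coef k a) = dirac0.
Proof.
intros Hk; unfold denom_seq.
rewrite conv_add_l, conv_scal_l.
replace (conv (seq_sub dirac0 (delta 1)) (b_coef k a))
  with (seq_sub (b_coef k a) (conv (delta 1) (b_coef k a))) by ring.
apply functional_extensionality; intros m; unfold seq_add, seq_sub, scal_seq.
rewrite !conv_delta; destruct m as [|m].
- rewrite b_coef_0 by exact Hk; destruct (Nat.leb_spec k 0); [lia|]; simpl; ring.
- rewrite b_coef_S by exact Hk; simpl (Nat.leb 1 (S m)); cbv iota.
  replace (S m - 1)%nat with m by lia.
  destruct (Nat.leb k (S m)); simpl dirac0; ring.
Qed.

(** * Identification of the law from its generating function *)

Lemma power_series_shift_zero (e : nat -> R) (M : R) :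
  (forall m, Rabs (e m) <= M) ->
  (forall z, 0 < z < 1 -> is_series (fun m => e m * z ^ m) 0) ->
  e 0%nat = 0 /\ (forall z, 0 < z < 1 -> is_series (fun m => e (S m) * z ^ m) 0).
Proof.
intros HM He.
assert (Hsh : forall z, 0 < z < 1 -> is_series (fun m => e (S m) * z ^ m) (- e 0%nat / z)).
{ intros z Hz.
  assert (H1 : is_series (fun m => e (S m) * z ^ S m) (- e 0%nat)).
  { apply (is_series_incr_1 (fun m => e m * z ^ m)).
    unfold plus; simpl; rewrite Rmult_1_r, Rplus_opp_l; apply He, Hz. }
  assert (H2 := is_series_scal_r (/ z) _ _ H1).
  apply is_series_ext with (2 := H2); intros m.
  change (e (S m) * (z * z ^ m) * / z = e (S m) * z ^ m); field; lra. }
assert (H0 : e 0%nat = 0).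
{ assert (HM0 : 0 <= M) by (generalize (HM 0%nat), (Rabs_pos (e 0%nat)); lra).
  (* Comparison with a geometric series bounds [|e 0|] by [M z / (1 - z)], which tends to 0 with
     [z]. *)
  assert (Hb : forall z, 0 < z < 1 -> Rabs (e 0%nat) * (1 - z) <= M * z).
  { intros z Hz.
    assert (Hg : is_series (fun m => z ^ m * M) (/ (1 - z) * M)).
    { apply is_series_scal_r, is_series_geom; rewrite Rabs_pos_eq; lra. }
    assert (Hle : forall m, Rabs (e (S m) * z ^ m) <= z ^ m * M).
    { intros m; assert (0 <= z ^ m) by (apply pow_le; lra).
      rewrite Rabs_mult, (Rabs_pos_eq (z ^ m)), Rmult_comm by assumption.
      apply Rmult_le_compat_l; auto. }
    assert (Ha : ex_series (fun m => Rabs (e (S m) * z ^ m))).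
    { apply (ex_series_le (fun m => Rabs (e (S m) * z ^ m)) (fun m => z ^ m * M));
        [|eexists; exact Hg].
      intros m; unfold norm; simpl; unfold abs; simpl; rewrite Rabs_Rabsolu; apply Hle. }
    assert (H : Rabs (- e 0%nat / z) <= / (1 - z) * M).
    { rewrite <- (is_series_unique _ _ (Hsh z Hz)), <- (is_series_unique _ _ Hg).
      eapply Rle_trans; [apply Series_Rabs, Ha|].
      apply Series_le; [|eexists; exact Hg]; intros m; split; [apply Rabs_pos|apply Hle]. }
    unfold Rdiv in H; rewrite Rabs_mult, Rabs_Ropp, (Rabs_pos_eq (/ z)) in H
      by (apply Rlt_le, Rinv_0_lt_compat; lra).
    apply Rmult_le_compat_r with (r := z * (1 - z)) in H; [|nra].
    replace (Rabs (e 0%nat) * / z * (z * (1 - z))) with (Rabs (e 0%nat) * (1 - z)) in H by (field; lra).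
    replace (/ (1 - z) * M * (z * (1 - z))) with (M * z) in H by (field; lra).
    exact H. }
  destruct (Req_dec (e 0%nat) 0) as [|Hne]; [assumption|exfalso].
  assert (Hp := Rabs_pos_lt _ Hne); set (r := Rabs (e 0%nat)) in *.
  (* Any [z] with [z (r + M) < r] contradicts [Hb]; this one gives [z (r + M) < r / 2]. *)
  assert (Hz : 0 < r / (2 * (r + M + 1)) < 1).
  { split; [apply Rdiv_lt_0_compat; lra|].
    apply Rmult_lt_reg_r with (2 * (r + M + 1)); [lra|].
    unfold Rdiv; rewrite Rmult_assoc, Rinv_l; lra. }
  specialize (Hb _ Hz); set (z := r / (2 * (r + M + 1))) in *.
  assert (Ez : z * (2 * (r + M + 1)) = r) by (unfold z; field; lra).
  nra. }
split; [exact H0|]; intros z Hz.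
replace 0 with (- e 0%nat / z) at 1 by (rewrite H0; field; lra).
apply Hsh, Hz.
Qed.

Lemma power_series_zero (e : nat -> R) (M : R) :
  (forall m, Rabs (e m) <= M) ->
  (forall z, 0 < z < 1 -> is_series (fun m => e m * z ^ m) 0) ->
  forall m, e m = 0.
Proof.
intros HM He m; revert e HM He; induction m as [|m IH]; intros e HM He;
  destruct (power_series_shift_zero e M HM He) as [H0 HS]; [exact H0|].
apply (IH (fun i => e (S i))); [intros; apply HM|exact HS].
Qed.

Lemma conv_eval (x y : nat -> R) (z : R) :
  conv (fun m => x m * z ^ m) (fun m => y m * z ^ m) = (fun m => conv x y m * z ^ m).
Proof.
apply functional_extensionality; intros m; unfold conv.
rewrite Rmult_comm, scal_sum; apply sum_eq; intros i Hi.
replace (z ^ m) with (z ^ i * z ^ (m - i)); [ring|].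
rewrite <- pow_add; f_equal; lia.
Qed.

Lemma abs_sum_delta_eval (j : nat) (z : R) :
  0 <= z -> abs_sum (fun m => delta j m * z ^ m) (z ^ j).
Proof.
intros Hz; apply abs_sum_nonneg.
- intros m; apply Rmult_le_pos; [unfold delta; destruct (Nat.eqb m j); lra|apply pow_le, Hz].
- exact (is_series_delta j (pow z)).
Qed.

Lemma denom_eval (k : nat) (a z : R) :
  0 <= z -> abs_sum (fun m => denom_seq k a m * z ^ m) (1 - z + a * z ^ k).
Proof.
intros Hz.
replace (fun m => denom_seq k a m * z ^ m) with
  (seq_add (seq_add (fun m => delta 0 m * z ^ m) (scal_seq (-1) (fun m => delta 1 m * z ^ m)))
    (scal_seq a (fun m => delta k m * z ^ m))).
- replace (1 - z + a * z ^ k) with (z ^ 0 + -1 * z ^ 1 + a * z ^ k) by ring.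
  repeat apply abs_sum_add; try apply abs_sum_scal; apply abs_sum_delta_eval, Hz.
- apply functional_extensionality; intros m.
  unfold denom_seq, seq_add, seq_sub, scal_seq; rewrite delta_0; ring.
Qed.

(** Multiplied by the denominator, the generating function is constantly [a] on [[0, 1]], so [e]
    evaluates to 0 there; absolute convergence at 1 bounds the coefficients of [e], which must then
    vanish. It remains to divide by the denominator, whose inverse is [b_coef]. *)
Lemma pgf_coefficients (k : nat) (a : R) (f : nat -> R) : (1 <= k)%nat -> 0 < a ->
  (forall m, 0 <= f m) ->
  (forall z, 0 <= z <= 1 -> is_series (fun m => f m * z ^ m) (a / (1 - z + a * z ^ k))) ->
  f = scal_seq a (b_coef k a).
Proof.
intros Hk Ha Hf0 Hf.
assert (Hpos : forall z, 0 <= z <= 1 -> 0 < 1 - z + a * z ^ k).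
{ intros z [Hz0 Hz1]; destruct (Req_dec z 1) as [->|Hne]; [rewrite pow1; lra|].
  assert (0 <= a * z ^ k) by (apply Rmult_le_pos; [lra|apply pow_le, Hz0]); lra. }
set (e := seq_sub (conv (denom_seq k a) f) (seq_cst a)).
assert (Hev : forall z, 0 <= z <= 1 -> abs_sum (fun m => e m * z ^ m) 0).
{ intros z Hz.
  assert (Hfz : abs_sum (fun m => f m * z ^ m) (a / (1 - z + a * z ^ k))).
  { apply abs_sum_nonneg; [|apply Hf, Hz].
    intros m; apply Rmult_le_pos; [apply Hf0|apply pow_le, Hz]. }
  assert (H1 := abs_sum_conv _ _ _ _ (denom_eval k a z (proj1 Hz)) Hfz).
  assert (H2 := abs_sum_scal (- a) _ _ (abs_sum_delta_eval 0 z (proj1 Hz))).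
  assert (H3 := abs_sum_add _ _ _ _ H1 H2).
  specialize (Hpos z Hz).
  replace (_ + _) with 0 in H3 by (simpl; field; lra).
  rewrite conv_eval in H3.
  replace (fun m => e m * z ^ m) with
    (seq_add (fun m => conv (denom_seq k a) f m * z ^ m)
      (scal_seq (- a) (fun m => delta 0 m * z ^ m))); [exact H3|].
  apply functional_extensionality; intros m.
  unfold e, seq_add, seq_sub, seq_cst, scal_seq; rewrite delta_0; ring. }
assert (He : conv (denom_seq k a) f = seq_cst a).
{ apply functional_extensionality; intros m; apply Rminus_diag_uniq; change (e m = 0).
  destruct (Hev 1 ltac:(lra)) as [Ha1 _].
  apply power_series_zero with (Series (fun m => Rabs (e m * 1 ^ m))).
  - intros i; replace (Rabs (e i)) with (Rabs (e i * 1 ^ i))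
      by (rewrite pow1, Rmult_1_r; reflexivity).
    apply Rle_trans with (sum_f_R0 (fun m => Rabs (e m * 1 ^ m)) i).
    + destruct i; simpl; [lra|].
      assert (0 <= sum_f_R0 (fun m => Rabs (e m * 1 ^ m)) i)
        by (apply cond_pos_sum; intros; apply Rabs_pos).
      simpl in *; lra.
    + apply sum_le_Series; [intros; apply Rabs_pos|exact Ha1].
  - intros z Hz; apply Hev; lra. }
transitivity (conv f (conv (denom_seq k a) (b_coef k a))).
- rewrite denom_b_coef by exact Hk; ring.
- rewrite conv_assoc, (conv_comm f), He, scal_seq_conv; reflexivity.
Qed.

(** * Growth of the coefficients *)

Lemma b_coef_add (k : nat) (a : R) (m : nat) : (1 <= k)%nat ->
  b_coef k a (S m + (k - 1)) = b_coef k a (m + (k - 1)) - a * b_coef k a m.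
Proof.
intros Hk; simpl; rewrite b_coef_S by exact Hk.
destruct (Nat.leb_spec k (S (m + (k - 1)))); [|lia].
do 3 f_equal; lia.
Qed.

Lemma b_coef_decr (k : nat) (a : R) : (1 <= k)%nat -> 0 < a ->
  (forall m, 0 <= b_coef k a m) -> forall m n, (m <= n)%nat -> b_coef k a n <= b_coef k a m.
Proof.
intros Hk Ha Hb m n H; induction H as [|n _ IH]; [lra|].
rewrite b_coef_S by exact Hk; destruct (Nat.leb k (S n)); [|lra].
specialize (Hb (S n - k)%nat); nra.
Qed.

(** A zero would spread forward by monotonicity and then backward through
    [a b_j = b_(j+k-1) - b_(j+k)], where [k >= 2] puts both right-hand indices above [j]. This
    contradicts [b_0 = 1]. *)
Lemma b_coef_pos (k : nat) (a : R) : (2 <= k)%nat -> 0 < a ->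
  (forall m, 0 <= b_coef k a m) -> forall m, 0 < b_coef k a m.
Proof.
intros Hk Ha Hb m; destruct (Hb m) as [|H0]; [assumption|exfalso].
assert (H : forall i j, (m <= i + j)%nat -> b_coef k a j = 0).
{ induction i as [|i IH]; intros j Hj.
  - apply Rle_antisym; [rewrite H0; apply b_coef_decr; trivial; lia|apply Hb].
  - assert (E := b_coef_add k a j ltac:(lia)).
    rewrite !IH in E by lia; nra. }
assert (E := H m 0%nat ltac:(lia)); rewrite b_coef_0 in E by lia; lra.
Qed.

(** Finiteness has to come before the value: summing [a b_m = b_(m+k-1) - b_(m+k)] by parts bounds
    the partial first moments by the sum of the [b_m]. The value then follows by applying
    [seq_euler] to [denom_seq k a] times [b_coef k a] equal to 1 and summing. *)
Lemma b_coef_first_moment (k : nat) (a : R) : (1 <= k)%nat -> 0 < a ->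
  (forall m, 0 <= b_coef k a m) -> is_series (b_coef k a) (1 / a) ->
  abs_sum (seq_euler (b_coef k a)) ((1 - INR k * a) / a ^ 2).
Proof.
intros Hk Ha Hb Hs.
assert (Hpos : forall m, 0 <= seq_euler (b_coef k a) m)
  by (intros; apply Rmult_le_pos; [apply pos_INR|apply Hb]).
assert (Hbound : forall N, a * sum_f_R0 (seq_euler (b_coef k a)) N
    + INR N * b_coef k a (S N + (k - 1)) <= sum_f_R0 (b_coef k a) N).
{ induction N as [|N IH].
  - unfold seq_euler; simpl; specialize (Hb 0%nat); lra.
  - cbn [sum_f_R0]; rewrite (b_coef_add k a (S N) Hk).
    assert (H := b_coef_decr k a Hk Ha Hb (S N) (S N + (k - 1)) ltac:(lia)).
    unfold seq_euler at 2; rewrite S_INR; lra. }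
assert (He : ex_series (seq_euler (b_coef k a))).
{ apply ex_series_bounded with (/ a * (1 / a)); [exact Hpos|].
  intros N; apply Rmult_le_reg_l with a; [exact Ha|].
  rewrite <- Rmult_assoc, Rinv_r, Rmult_1_l by lra.
  assert (HN : sum_f_R0 (b_coef k a) N <= 1 / a).
  { rewrite <- (is_series_unique _ _ Hs); apply sum_le_Series; [exact Hb|exists (1 / a); exact Hs]. }
  assert (0 <= INR N * b_coef k a (S N + (k - 1)))
    by (apply Rmult_le_pos; [apply pos_INR|apply Hb]).
  specialize (Hbound N); lra. }
assert (Hsum := abs_sum_nonneg _ _ Hpos (Series_correct _ He)).
assert (HP : abs_sum (denom_seq k a) a).
{ replace a with (1 + (-1) * 1 + a * 1) at 2 by ring.
  replace (denom_seq k a)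
    with (seq_add (seq_add (delta 0) (scal_seq (-1) (delta 1))) (scal_seq a (delta k))).
  - repeat apply abs_sum_add; try apply abs_sum_scal; apply abs_sum_delta.
  - rewrite delta_0; apply functional_extensionality; intros m.
    unfold denom_seq, seq_add, seq_sub, scal_seq; ring. }
assert (HP' : abs_sum (seq_euler (denom_seq k a)) (-1 + INR k * a)).
{ replace (-1 + INR k * a) with (-1 * 1 + a * INR k * 1) by ring.
  replace (seq_euler (denom_seq k a))
    with (seq_add (scal_seq (-1) (delta 1)) (scal_seq (a * INR k) (delta k))).
  - apply abs_sum_add; apply abs_sum_scal, abs_sum_delta.
  - apply functional_extensionality; intros m.
    assert (E0 := f_equal (fun g => g m) (seq_euler_delta 0)).
    assert (E1 := f_equal (fun g => g m) (seq_euler_delta 1)).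
    assert (Ek := f_equal (fun g => g m) (seq_euler_delta k)).
    rewrite delta_0 in E0; cbv beta in *; unfold seq_euler, scal_seq in E0, E1, Ek.
    simpl (INR 0) in E0; simpl (INR 1) in E1.
    unfold seq_euler, denom_seq, seq_add, seq_sub, scal_seq.
    transitivity (INR m * dirac0 m - INR m * delta 1 m + a * (INR m * delta k m)); [|ring].
    rewrite E0, E1, Ek; ring. }
assert (HB : abs_sum (b_coef k a) (1 / a)) by (apply abs_sum_nonneg; assumption).
assert (H := abs_sum_euler_conv _ _ _ _ _ _ HP HB HP' Hsum).
rewrite denom_b_coef, <- delta_0, seq_euler_delta in H by exact Hk.
assert (H0 := abs_sum_scal (INR 0) _ _ (abs_sum_delta 0)).
assert (E := is_series_unique _ _ (proj2 H)).
rewrite (is_series_unique _ _ (proj2 H0)) in E; simpl (INR 0) in E.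
replace ((1 - INR k * a) / a ^ 2) with (Series (seq_euler (b_coef k a))); [exact Hsum|].
apply Rmult_eq_reg_l with a; [|lra].
replace (a * ((1 - INR k * a) / a ^ 2)) with (- ((-1 + INR k * a) * (1 / a))) by (field; lra).
lra.
Qed.

(** The first moment [(1 - k a) / a^2] is at least [b_1], which is 1 for [k >= 2] and [1 - a] for
    [k = 1]. *)
Lemma b_coef_mean_pos (k : nat) (a : R) : (1 <= k)%nat -> 0 < a < 1 ->
  (forall m, 0 <= b_coef k a m) -> is_series (b_coef k a) (1 / a) -> INR k * a < 1.
Proof.
intros Hk Ha Hb Hs.
destruct (b_coef_first_moment k a Hk (proj1 Ha) Hb Hs) as [_ H].
assert (Hpos : forall m, 0 <= seq_euler (b_coef k a) m)
  by (intros; apply Rmult_le_pos; [apply pos_INR|apply Hb]).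
assert (H1 : 0 < b_coef k a 1).
{ rewrite b_coef_S, b_coef_0 by exact Hk.
  destruct (Nat.leb_spec k 1); [|lra].
  replace (1 - k)%nat with 0%nat by lia; rewrite b_coef_0 by exact Hk; lra. }
assert (Hle := sum_le_Series _ 1 Hpos (ex_intro _ _ H)).
rewrite (is_series_unique _ _ H) in Hle; unfold seq_euler in Hle; simpl in Hle.
apply Rnot_le_lt; intros Hge.
assert ((1 - INR k * a) / (a * (a * 1)) <= 0).
{ assert (0 < / (a * (a * 1))) by (apply Rinv_0_lt_compat; nra).
  unfold Rdiv; nra. }
lra.
Qed.

(** An arithmetic-geometric mean inequality: consecutive left-hand sides drop by
    [(j + 1) y^j (1 - y)^2]. *)
Lemma pow_mul_affine_le_1 (j : nat) (y : R) : 0 <= y -> y ^ j * (INR j + 1 - INR j * y) <= 1.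
Proof.
intros Hy; induction j as [|j IH]; [simpl; lra|].
eapply Rle_trans; [|exact IH].
rewrite S_INR; simpl pow.
assert (0 <= (INR j + 1) * (y ^ j * (1 - y) ^ 2)).
{ apply Rmult_le_pos; [generalize (pos_INR j); lra|].
  apply Rmult_le_pos; [apply pow_le, Hy|apply pow2_ge_0]. }
nra.
Qed.

(** The maximum is at [x = 1 - 1/k]; rescaling by this point gives the previous inequality. *)
Lemma pow_mul_compl_le (k : nat) (x : R) : (2 <= k)%nat -> 0 <= x ->
  x ^ (k - 1) * (1 - x) <= (1 - / INR k) ^ (k - 1) * / INR k.
Proof.
intros Hk Hx.
assert (Hk2 : 2 <= INR k) by (change 2 with (INR 2); apply le_INR, Hk).
assert (Hi : / INR k <= / 2) by (apply Rinv_le_contravar; lra).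
assert (Hx0 : 0 < 1 - / INR k) by lra.
assert (H := pow_mul_affine_le_1 (k - 1) (x / (1 - / INR k))
  ltac:(apply Rmult_le_pos; [exact Hx|apply Rlt_le, Rinv_0_lt_compat, Hx0])).
rewrite minus_INR in H by lia; simpl (INR 1) in H.
unfold Rdiv in H; rewrite Rpow_mult_distr, pow_inv in H.
apply Rmult_le_compat_l with (r := (1 - / INR k) ^ (k - 1) * / INR k) in H.
2:{ apply Rmult_le_pos; [apply pow_le; lra|apply Rlt_le, Rinv_0_lt_compat; lra]. }
rewrite Rmult_1_r in H; eapply Rle_trans; [|exact H]; right.
field; split; [|split; [|apply pow_nonzero]]; lra.
Qed.

Lemma b_coef_pow_le (k : nat) (a x : R) (J d m : nat) :
  0 <= x -> (forall i, (J <= i)%nat -> b_coef k a (S i) <= x * b_coef k a i) ->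
  (J <= m)%nat -> b_coef k a (m + d) <= x ^ d * b_coef k a m.
Proof.
intros Hx H Hm; induction d as [|d IH]; [rewrite Nat.add_0_r; simpl; lra|].
rewrite Nat.add_succ_r; eapply Rle_trans; [apply H; lia|].
simpl; rewrite Rmult_assoc; apply Rmult_le_compat_l; assumption.
Qed.

(* If [a] exceeded the maximum of [x^(k-1) (1 - x)], every pass of the recursion would lower the
   ratios [b (m+1) / b m] by a fixed amount, and they would eventually become negative. *)
Lemma b_coef_a_bound (k : nat) (a : R) : (2 <= k)%nat -> 0 < a ->
  (forall m, 0 <= b_coef k a m) -> a <= (1 - / INR k) ^ (k - 1) * / INR k.
Proof.
intros Hk Ha Hb; apply Rnot_lt_le; intros Hlt.
set (M := (1 - / INR k) ^ (k - 1) * / INR k) in *; set (d := a - M).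
assert (Hd : 0 < d) by (unfold d; lra).
assert (Hpos := b_coef_pos k a Hk Ha Hb).
assert (H : forall i m, (i * k <= m)%nat -> b_coef k a (S m) <= (1 - INR i * d) * b_coef k a m).
{ induction i as [|i IH]; intros m Hm.
  - simpl (INR 0); rewrite Rmult_0_l, Rminus_0_r, Rmult_1_l.
    apply b_coef_decr; trivial; lia.
  - set (x := 1 - INR i * d) in *.
    assert (Hx : 0 < x).
    { apply Rnot_le_lt; intros Hx.
      assert (H1 := IH m ltac:(lia)); generalize (Hpos (S m)), (Hpos m); nra. }
    assert (Hx1 : x <= 1) by (unfold x; generalize (pos_INR i); nra).
    assert (Hp : b_coef k a m <= x ^ (k - 1) * b_coef k a (m - (k - 1))).
    { replace m with (m - (k - 1) + (k - 1))%nat at 1 by lia.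
      apply b_coef_pow_le with (i * k)%nat; [lra|exact IH|lia]. }
    assert (Hxp : 0 < x ^ (k - 1) <= 1).
    { split; [apply pow_lt, Hx|].
      replace 1 with (1 ^ (k - 1)) by apply pow1; apply pow_incr; lra. }
    assert (HM := pow_mul_compl_le k x Hk (Rlt_le _ _ Hx)); fold M in HM.
    assert (E := b_coef_add k a (m - (k - 1)) ltac:(lia)).
    replace (S (m - (k - 1)) + (k - 1))%nat with (S m) in E by lia.
    replace (m - (k - 1) + (k - 1))%nat with m in E by lia.
    rewrite E, S_INR.
    replace (1 - (INR i + 1) * d) with (x - d) by (unfold x; ring).
    set (y := x ^ (k - 1)) in *.
    assert (Hp2 := Hpos (m - (k - 1))%nat); set (c := b_coef k a (m - (k - 1))) in *.
    (* This is [1 - a / y <= x - d], the drop of the ratio by [d]; it combines [y (1 - x) <= M] with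
       [y <= 1]. *)
    assert (Hxd : y * (1 - x + d) <= a) by (unfold d in *; nra).
    assert (H1 : b_coef k a m * (1 - x + d) <= y * c * (1 - x + d))
      by (apply Rmult_le_compat_r; lra).
    assert (H2 : c * (y * (1 - x + d)) <= c * a) by (apply Rmult_le_compat_l; lra).
    lra. }
destruct (INR_unbounded (/ d)) as [i Hi].
assert (Hid : 1 < INR i * d).
{ apply Rmult_lt_compat_r with (r := d) in Hi; [|exact Hd].
  rewrite Rinv_l in Hi by lra; lra. }
assert (H1 := H i (i * k)%nat (le_n _)).
generalize (Hpos (S (i * k))), (Hpos (i * k)%nat); nra.
Qed.

(** The ratio [x = 1 - 1/k] reproduces itself: if it holds on the preceding steps, then
    [b_(m-k+1) <= b_m / x^(k-1)], and [a <= x^(k-1) (1 - x)] lets the recursion subtract at most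
    [(1 - x) b_m]. *)
Lemma b_coef_ratio_ge (k : nat) (a : R) : (2 <= k)%nat -> 0 < a ->
  (forall m, 0 <= b_coef k a m) -> forall m, (1 - / INR k) * b_coef k a m <= b_coef k a (S m).
Proof.
intros Hk Ha Hb m.
assert (HM := b_coef_a_bound k a Hk Ha Hb).
assert (Hk2 : 2 <= INR k) by (change 2 with (INR 2); apply le_INR, Hk).
assert (Hi : / INR k <= / 2) by (apply Rinv_le_contravar; lra).
assert (Hi0 : 0 < / INR k) by (apply Rinv_0_lt_compat; lra).
set (x := 1 - / INR k) in *.
induction m as [m IH] using (well_founded_induction Wf_nat.lt_wf).
rewrite b_coef_S by lia.
destruct (Nat.leb_spec k (S m)) as [H|H]; [|specialize (Hb m); unfold x; nra].
replace (S m - k)%nat with (m - (k - 1))%nat by lia.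
assert (Hp : x ^ (k - 1) * b_coef k a (m - (k - 1)) <= b_coef k a m).
{ replace m with (m - (k - 1) + (k - 1))%nat at 2 by lia.
  assert (Hd : forall d, (d <= k - 1)%nat ->
    x ^ d * b_coef k a (m - (k - 1)) <= b_coef k a (m - (k - 1) + d)).
  { induction d as [|d IHd]; intros Hd; [rewrite Nat.add_0_r; simpl; lra|].
    rewrite Nat.add_succ_r; eapply Rle_trans; [|apply IH; lia].
    simpl; rewrite Rmult_assoc; apply Rmult_le_compat_l; [unfold x; lra|apply IHd; lia]. }
  apply Hd; lia. }
assert (Hc := Hb (m - (k - 1))%nat); set (c := b_coef k a (m - (k - 1))) in *.
assert (H1 : a * c <= x ^ (k - 1) * / INR k * c) by (apply Rmult_le_compat_r; assumption).
assert (H2 : x ^ (k - 1) * c * / INR k <= b_coef k a m * / INR k)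
  by (apply Rmult_le_compat_r; lra).
unfold x at 1; lra.
Qed.

Lemma b_coef_a_le_quarter (k : nat) (a : R) : (2 <= k)%nat -> 0 < a ->
  (forall m, 0 <= b_coef k a m) -> a <= / 4.
Proof.
intros Hk Ha Hb; eapply Rle_trans; [apply b_coef_a_bound; eassumption|].
assert (Hk2 : 2 <= INR k) by (change 2 with (INR 2); apply le_INR, Hk).
assert (Hi : / INR k <= / 2) by (apply Rinv_le_contravar; lra).
assert (Hi0 : 0 < / INR k) by (apply Rinv_0_lt_compat; lra).
set (y := / INR k) in *.
replace (k - 1)%nat with (S (k - 2)) by lia; simpl pow.
assert (Hp : 0 <= (1 - y) ^ (k - 2) <= 1).
{ split; [apply pow_le; lra|].
  replace 1 with (1 ^ (k - 2)) at 2 by apply pow1; apply pow_incr; lra. }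
assert ((1 - y) * y <= / 4) by (assert (0 <= (y - / 2) ^ 2) by apply pow2_ge_0; nra).
assert (0 <= (1 - y) * y) by nra.
replace ((1 - y) * (1 - y) ^ (k - 2) * y) with ((1 - y) * y * (1 - y) ^ (k - 2)) by ring.
nra.
Qed.

(** * Smoothness of convolution powers *)

(** The differences telescope to [x M] on the way up, counted from 0, and to at most [x M] on the
    way down. *)
Lemma unimodal_l1_le (x : nat -> R) (M : nat) :
  (forall m, 0 <= x m) -> (forall m, (m < M)%nat -> x m <= x (S m)) ->
  (forall m, (M <= m)%nat -> x (S m) <= x m) ->
  l1_le (conv (seq_sub dirac0 (delta 1)) x) (2 * x M).
Proof.
intros Hx Hup Hdown.
set (S1 := sum_f_R0 (fun m => Rabs (conv (seq_sub dirac0 (delta 1)) x m))).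
assert (HU : forall N, (N <= M)%nat -> S1 N = x N).
{ induction N as [|N IH]; intros HN.
  - unfold S1; simpl; rewrite conv_diff_0, Rabs_pos_eq; auto.
  - change (S1 (S N)) with (S1 N + Rabs (conv (seq_sub dirac0 (delta 1)) x (S N))).
    rewrite conv_diff_S, IH by lia.
    rewrite Rabs_pos_eq by (specialize (Hup N ltac:(lia)); lra); ring. }
assert (HD : forall i, S1 (M + i)%nat = 2 * x M - x (M + i)%nat).
{ induction i as [|i IH].
  - rewrite Nat.add_0_r, HU by lia; ring.
  - rewrite Nat.add_succ_r.
    change (S1 (S (M + i))) with (S1 (M + i)%nat + Rabs (conv (seq_sub dirac0 (delta 1)) x (S (M + i)))).
    rewrite conv_diff_S, IH.
    rewrite Rabs_left1 by (specialize (Hdown (M + i)%nat ltac:(lia)); lra); ring. }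
intros N; fold (S1 N); destruct (Nat.le_gt_cases M N) as [H|H].
- replace N with (M + (N - M))%nat by lia; rewrite HD; specialize (Hx (M + (N - M))%nat); lra.
- rewrite HU by lia.
  assert (Hmono : forall d, (N + d <= M)%nat -> x N <= x (N + d)%nat).
  { induction d as [|d IH]; intros Hd; [rewrite Nat.add_0_r; lra|].
    rewrite Nat.add_succ_r; eapply Rle_trans; [apply IH; lia|apply Hup; lia]. }
  specialize (Hmono (M - N)%nat ltac:(lia)); replace (N + (M - N))%nat with M in Hmono by lia.
  specialize (Hx N); lra.
Qed.

(* Law of the sum of [n] independent geometric variables of parameter 1/2. *)
Definition nb_half (n m : nat) : R := gbinom (INR n) m / 2 ^ (n + m).

(** Coefficientwise form of [(1 - z) (1 - z)^(-alpha-1) = (1 - z)^(-alpha)]. *)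
Lemma gbinom_pascal (alpha : R) (m : nat) : 0 < alpha ->
  gbinom (alpha + 1) (S m) - gbinom (alpha + 1) m = gbinom alpha (S m).
Proof.
intros Ha.
assert (H : forall m, alpha * gbinom (alpha + 1) m = (alpha + INR m) * gbinom alpha m).
{ clear m; induction m as [|m IH]; [simpl; ring|].
  assert (Hm := pos_INR m); cbn [gbinom].
  replace (alpha * (gbinom (alpha + 1) m * (alpha + 1 + INR m) / INR (S m)))
    with (alpha * gbinom (alpha + 1) m * (alpha + 1 + INR m) / INR (S m))
    by (rewrite S_INR; field; lra).
  rewrite IH, S_INR; field; lra. }
assert (Hm := pos_INR m); cbn [gbinom].
apply Rmult_eq_reg_l with alpha; [|lra].
replace (alpha * _) with (alpha * gbinom (alpha + 1) m * (alpha / INR (S m)))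
  by (rewrite S_INR; field; lra).
rewrite H, S_INR; field; lra.
Qed.

(** The generating function of [nb_half n] is [(2 - z)^(-n)]. *)
Lemma nb_half_S (n : nat) : (1 <= n)%nat ->
  conv (seq_sub (seq_cst 2) (delta 1)) (nb_half (S n)) = nb_half n.
Proof.
intros Hn.
replace (conv (seq_sub (seq_cst 2) (delta 1)) (nb_half (S n)))
  with (seq_sub (conv (seq_cst 2) (nb_half (S n))) (conv (delta 1) (nb_half (S n)))) by ring.
rewrite <- scal_seq_conv.
apply functional_extensionality; intros [|m]; unfold seq_sub, scal_seq; rewrite conv_delta;
  simpl (Nat.leb _ _); cbv iota; unfold nb_half.
- simpl; rewrite Nat.add_0_r; field; apply pow_nonzero; lra.
- replace (S m - 1)%nat with m by lia.
  rewrite <- (gbinom_pascal (INR n)), <- S_INR by (apply lt_0_INR; lia).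
  replace (S n + S m)%nat with (S (n + S m)) by lia; replace (S n + m)%nat with (n + S m)%nat by lia.
  simpl pow; field; apply pow_nonzero; lra.
Qed.

Lemma nb_half_1 : conv (seq_sub (seq_cst 2) (delta 1)) (nb_half 1) = dirac0.
Proof.
replace (conv (seq_sub (seq_cst 2) (delta 1)) (nb_half 1))
  with (seq_sub (conv (seq_cst 2) (nb_half 1)) (conv (delta 1) (nb_half 1))) by ring.
rewrite <- scal_seq_conv.
assert (H1 : forall m, gbinom 1 m = 1).
{ induction m as [|m IH]; [reflexivity|].
  cbn [gbinom]; rewrite IH, S_INR; generalize (pos_INR m); intros; field; lra. }
apply functional_extensionality; intros [|m]; unfold seq_sub, scal_seq; rewrite conv_delta;
  simpl (Nat.leb _ _); cbv iota; unfold nb_half; simpl (INR 1); rewrite !H1; simpl.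
- field.
- rewrite Nat.sub_0_r; field; apply pow_nonzero; lra.
Qed.

Lemma nb_half_pow (n : nat) : (1 <= n)%nat -> conv_pow n (nb_half 1) = nb_half n.
Proof.
intros Hn; induction Hn as [|n Hn IH].
- change (conv (nb_half 1) dirac0 = nb_half 1); ring.
- rewrite conv_pow_S, IH, <- (nb_half_S n Hn).
  rewrite conv_assoc, (conv_comm (nb_half 1)), nb_half_1; ring.
Qed.

Lemma nb_half_pos (n m : nat) : (1 <= n)%nat -> 0 < nb_half n m.
Proof.
intros Hn; apply Rdiv_lt_0_compat; [apply gbinom_pos, lt_0_INR; lia|apply pow_lt; lra].
Qed.

Lemma nb_half_ratio (n m : nat) :
  nb_half n (S m) = nb_half n m * ((INR n + INR m) / (2 * INR (S m))).
Proof.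
unfold nb_half; cbn [gbinom]; rewrite Nat.add_succ_r; simpl pow.
field; split; [apply not_0_INR; lia|apply pow_nonzero; lra].
Qed.

(** The ratio [(n + 1 + m) / (2 (m + 1))] equals 1 at [m = n - 1], so [n] is a mode of the law with
    [n + 1] summands. *)
Lemma nb_half_l1_le (n : nat) :
  l1_le (conv (seq_sub dirac0 (delta 1)) (nb_half (S n))) (2 * nb_half (S n) n).
Proof.
apply unimodal_l1_le.
- intros; apply Rlt_le, nb_half_pos; lia.
- intros m Hm; rewrite nb_half_ratio.
  rewrite <- (Rmult_1_r (nb_half (S n) m)) at 1.
  apply Rmult_le_compat_l; [apply Rlt_le, nb_half_pos; lia|].
  assert (H := le_INR _ _ Hm); rewrite !S_INR in *; generalize (pos_INR m); intros.
  apply Rmult_le_reg_r with (2 * (INR m + 1)); [lra|].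
  unfold Rdiv; rewrite Rmult_assoc, Rinv_l; lra.
- intros m Hm; rewrite nb_half_ratio.
  rewrite <- (Rmult_1_r (nb_half (S n) m)) at 2.
  apply Rmult_le_compat_l; [apply Rlt_le, nb_half_pos; lia|].
  assert (H := le_INR _ _ Hm); rewrite !S_INR in *; generalize (pos_INR m); intros.
  apply Rmult_le_reg_r with (2 * (INR m + 1)); [lra|].
  unfold Rdiv; rewrite Rmult_assoc, Rinv_l; lra.
Qed.

(* The mode carries mass [binom(2n, n) / 4^n / 2]. *)
Lemma nb_half_mode (n : nat) : (2 * nb_half (S n) n) ^ 2 * (3 * INR n + 1) <= 1.
Proof.
induction n as [|n IH].
- unfold nb_half; simpl; lra.
- assert (Hn := pos_INR n).
  assert (E : nb_half (S (S n)) (S n) = nb_half (S n) n * ((2 * INR n + 1) / (2 * INR n + 2))).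
  { assert (E1 := nb_half_ratio (S n) n).
    assert (E2 : (INR n + 1) * gbinom (INR (S (S n))) (S n)
      = (INR (S n) + INR (S n)) * gbinom (INR (S n)) (S n)).
    { assert (P := gbinom_pascal (INR (S n)) n ltac:(apply lt_0_INR; lia)).
      assert (Q := gbinom_S (INR (S n) + 1) n).
      rewrite <- (S_INR (S n)) in P, Q.
      rewrite <- P.
      set (u := gbinom (INR (S (S n))) n) in *; set (v := gbinom (INR (S (S n))) (S n)) in *.
      rewrite (S_INR (S n)), S_INR in Q; rewrite S_INR; lra. }
    replace (nb_half (S (S n)) (S n)) with (nb_half (S n) (S n)).
    - rewrite E1, !S_INR; field; lra.
    - unfold nb_half.
      replace (gbinom (INR (S (S n))) (S n)) with (2 * gbinom (INR (S n)) (S n)).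
      + replace (S (S n) + S n)%nat with (S (S n + S n)) by lia; simpl pow.
        field; apply pow_nonzero; lra.
      + apply Rmult_eq_reg_l with (INR n + 1); [|lra]; rewrite E2, S_INR; ring. }
  rewrite E, S_INR.
  eapply Rle_trans; [|exact IH].
  set (u := nb_half (S n) n).
  replace ((2 * (u * ((2 * INR n + 1) / (2 * INR n + 2)))) ^ 2 * (3 * (INR n + 1) + 1))
    with ((2 * u) ^ 2 * ((2 * INR n + 1) ^ 2 * (3 * INR n + 4) / (2 * INR n + 2) ^ 2))
    by (field; lra).
  apply Rmult_le_compat_l; [apply pow2_ge_0|].
  (* After clearing denominators the two sides differ by exactly [n], which is why the factor
     [3 n + 1] is inductive. *)
  apply Rmult_le_reg_r with ((2 * INR n + 2) ^ 2); [nra|].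
  unfold Rdiv; rewrite Rmult_assoc, Rinv_l by nra.
  nra.
Qed.

(** Three terms of the Leibniz series: [PI / 4 <= 1 - 1/3 + 1/5]. *)
Lemma PI_le_7_2 : PI <= 7 / 2.
Proof.
generalize (proj2 (PI_ineq 1)); unfold tg_alt, PI_tg; simpl; lra.
Qed.

(** The cofactor of the geometric law is [(2 - z) f]: its coefficients [2 f_m - f_(m-1)] are
    nonnegative by the ratio hypothesis, and its mass is [2 - 1 = 1]. Convolution with its powers
    does not increase the l1 norm. *)
Lemma half_decay_smoothness (f : nat -> R) (n : nat) :
  (forall m, 0 <= f m) -> is_series f 1 -> (forall m, f m / 2 <= f (S m)) ->
  l1_le (conv (seq_sub dirac0 (delta 1)) (conv_pow (S n) f)) (2 * nb_half (S n) n).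
Proof.
intros Hf H1 Hhalf.
set (psi := conv (seq_sub (seq_cst 2) (delta 1)) f).
assert (Hpsi : psi = seq_add (scal_seq 2 f) (scal_seq (-1) (conv (delta 1) f))).
{ rewrite !scal_seq_conv; unfold psi.
  replace (seq_cst (-1)) with (seq_opp dirac0)
    by (apply functional_extensionality; intros m; unfold seq_opp, seq_cst, scal_seq; ring).
  ring. }
assert (Hpos : forall m, 0 <= psi m).
{ intros m; rewrite Hpsi; unfold seq_add, scal_seq; rewrite conv_delta.
  destruct m as [|m]; simpl; [specialize (Hf 0%nat); lra|].
  rewrite Nat.sub_0_r; specialize (Hhalf m); lra. }
assert (Hf1 : abs_sum f 1) by (apply abs_sum_nonneg; assumption).
assert (Hpsi1 : abs_sum psi 1).
{ rewrite Hpsi; replace 1 with (2 * 1 + -1 * (1 * 1)) by ring.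
  apply abs_sum_add; apply abs_sum_scal; [exact Hf1|].
  apply abs_sum_conv; [apply abs_sum_delta|exact Hf1]. }
assert (Ef : f = conv (nb_half 1) psi).
{ unfold psi; rewrite conv_assoc, (conv_comm (nb_half 1)), nb_half_1; ring. }
rewrite Ef, conv_pow_mul, nb_half_pow, conv_assoc by lia.
rewrite <- (Rmult_1_r (2 * _)); apply l1_le_conv; [apply nb_half_l1_le|].
apply l1_le_nonneg; [apply conv_pow_nonneg, Hpos|].
apply abs_sum_pow, Hpsi1.
Qed.

Lemma smoothness_bound (k n : nat) (a : R) : (2 <= k)%nat -> (1 <= n)%nat -> 0 < a ->
  (forall m, 0 <= b_coef k a m) -> is_series (b_coef k a) (1 / a) ->
  l1_le (conv (seq_sub dirac0 (delta 1)) (conv_pow n (scal_seq a (b_coef k a))))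
    (sqrt (2 / PI) / sqrt (1 / 4 + INR n * (1 - a / 2 * (1 + a)))).
Proof.
intros Hk Hn Ha Hb Hs.
assert (Ha4 := b_coef_a_le_quarter k a Hk Ha Hb).
set (f := scal_seq a (b_coef k a)).
assert (Hf : forall m, 0 <= f m) by (intros; apply Rmult_le_pos; [lra|apply Hb]).
assert (Hf1 : is_series f 1).
{ replace 1 with (a * (1 / a)) by (field; lra); apply is_series_scal_seq, Hs. }
assert (HPI := PI_le_7_2); assert (HPI0 := PI_RGT_0).
assert (H2PI : 4 / 7 <= 2 / PI).
{ apply Rmult_le_reg_r with PI; [exact HPI0|].
  unfold Rdiv at 2; rewrite Rmult_assoc, Rinv_l; lra. }
set (v := 1 / 4 + INR n * (1 - a / 2 * (1 + a))).
assert (Hn1 : 1 <= INR n) by (change 1 with (INR 1); apply le_INR, Hn).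
assert (Hv : 0 < v <= 1 / 4 + INR n).
{ unfold v; assert (0 <= a / 2 * (1 + a) <= 1) by nra; nra. }
(* The constant [4/7] is [2 / (7/2)], and [v] is replaced by its upper bound [1/4 + n]. *)
assert (Hsuff : forall y, 0 <= y -> y ^ 2 * (1 / 4 + INR n) <= 4 / 7 ->
  y <= sqrt (2 / PI) / sqrt v).
{ intros y Hy H.
  rewrite <- sqrt_div_alt by lra.
  rewrite <- (sqrt_pow2 y Hy); apply sqrt_le_1_alt.
  apply Rmult_le_reg_r with v; [lra|].
  unfold Rdiv at 1; rewrite Rmult_assoc, Rinv_l, Rmult_1_r by lra.
  apply Rle_trans with (y ^ 2 * (1 / 4 + INR n)); [|lra].
  apply Rmult_le_compat_l; [apply pow2_ge_0|lra]. }
(* For one summand the geometric mode only gives the bound 1, which is too large. Instead [f] is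
   nonincreasing with [f 0 = a <= 1/4], and [(1/2)^2 (5/4) <= 4/7]. *)
destruct (Nat.eq_dec n 1) as [->|Hne].
- intros N; apply Rle_trans with (2 * f 0%nat).
  + change (conv_pow 1 f) with (conv f dirac0); rewrite (conv_comm f), conv_1_l.
    apply unimodal_l1_le; [exact Hf|lia|].
    intros m _; apply Rmult_le_compat_l; [lra|apply b_coef_decr; trivial; lia].
  + apply Hsuff; unfold f, scal_seq; rewrite b_coef_0 by lia; simpl; nra.
- intros N; destruct n as [|n]; [lia|].
  eapply Rle_trans; [apply half_decay_smoothness; try assumption|].
  + intros m; unfold f, scal_seq.
    assert (Hk2 : 2 <= INR k) by (change 2 with (INR 2); apply le_INR, Hk).
    assert (Hi : / INR k <= / 2) by (apply Rinv_le_contravar; lra).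
    assert (H := b_coef_ratio_ge k a Hk Ha Hb m); specialize (Hb m).
    assert (/ INR k * b_coef k a m <= / 2 * b_coef k a m) by (apply Rmult_le_compat_r; lra).
    assert (b_coef k a m / 2 <= b_coef k a (S m)) by lra.
    nra.
  + assert (H := nb_half_mode n).
    assert (Hn2 : 1 <= INR n) by (change 1 with (INR 1); apply le_INR; lia).
    apply Hsuff.
    * generalize (nb_half_pos (S n) n ltac:(lia)); lra.
    (* With one more summand than [n], the claim is [y (n + 5/4) <= 4/7]; it follows from
       [y (3 n + 1) <= 1] once [n >= 19/20]. *)
    * rewrite S_INR; set (y := (2 * nb_half (S n) n) ^ 2) in *.
      assert (0 <= y) by apply pow2_ge_0; nra.
Qed.

(** * The total variation bound *)

(** Covers both polynomial factors of [c(z)], namely [1 - q z] and [1 - k a z^(k-1)]. *)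
Definition one_minus (r : R) (j : nat) : nat -> R := seq_sub dirac0 (scal_seq r (delta j)).

Lemma conv_one_minus (r : R) (j : nat) (x : nat -> R) :
  conv (one_minus r j) x = seq_sub x (scal_seq r (conv (delta j) x)).
Proof.
unfold one_minus.
rewrite <- conv_scal_l; ring.
Qed.

Lemma abs_sum_one_minus (r : R) (j : nat) : abs_sum (one_minus r j) (1 - r).
Proof.
replace (one_minus r j) with (seq_add (delta 0) (scal_seq (- r) (delta j))).
- replace (1 - r) with (1 + - r * 1) by ring.
  apply abs_sum_add; [|apply abs_sum_scal]; apply abs_sum_delta.
- rewrite delta_0; apply functional_extensionality; intros m.
  unfold one_minus, seq_add, seq_sub, scal_seq; ring.
Qed.

Lemma abs_sum_euler_one_minus (r : R) (j : nat) :
  abs_sum (seq_euler (one_minus r j)) (- r * INR j).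
Proof.
replace (seq_euler (one_minus r j)) with (scal_seq (- r * INR j) (delta j)).
- rewrite <- (Rmult_1_r (- r * INR j)) at 2; apply abs_sum_scal, abs_sum_delta.
- apply functional_extensionality; intros m.
  assert (Ej := f_equal (fun g => g m) (seq_euler_delta j)); cbv beta in Ej.
  assert (E0 : INR m * dirac0 m = 0) by (destruct m; simpl; ring).
  unfold seq_euler, one_minus, seq_sub, scal_seq in *.
  transitivity (INR m * dirac0 m - r * (INR m * delta j m)); [rewrite E0, Ej|]; ring.
Qed.

(* Logarithmic derivative of the generating function. *)
Lemma pgf_deriv (k : nat) (a : R) : (1 <= k)%nat ->
  let f := scal_seq a (b_coef k a) in
  seq_deriv f = conv (conv (one_minus (INR k * a) (k - 1)) (b_coef k a)) f.
Proof.
intros Hk f.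
assert (HPb := denom_b_coef k a Hk).
assert (HP : seq_deriv (denom_seq k a) = seq_opp (one_minus (INR k * a) (k - 1))).
{ apply functional_extensionality; intros m.
  unfold seq_deriv, denom_seq, seq_opp, one_minus, seq_add, seq_sub, scal_seq, delta; cbn [dirac0].
  destruct (Nat.eqb_spec (S m) 1), (Nat.eqb_spec (S m) k), (Nat.eqb_spec m (k - 1)); try lia;
    destruct m; try lia; subst; cbn [dirac0]; try (simpl; ring). }
assert (HD : seq_add (conv (seq_opp (one_minus (INR k * a) (k - 1))) (b_coef k a))
    (conv (denom_seq k a) (seq_deriv (b_coef k a))) = seq_zero).
{ rewrite <- HP, <- seq_deriv_conv, HPb.
  apply functional_extensionality; intros m; unfold seq_deriv, seq_zero; simpl; ring. }
assert (Hb : seq_deriv (b_coef k a)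
  = conv (conv (one_minus (INR k * a) (k - 1)) (b_coef k a)) (b_coef k a)).
{ set (u := one_minus (INR k * a) (k - 1)) in *; set (b := b_coef k a) in *.
  set (P := denom_seq k a) in *; set (b' := seq_deriv b) in *.
  transitivity (conv (conv P b) b'); [rewrite HPb; ring|].
  transitivity (conv b (seq_add (seq_add (conv (seq_opp u) b) (conv P b')) (conv u b))); [ring|].
  rewrite HD; ring. }
unfold f; rewrite conv_scal_r, <- Hb.
apply functional_extensionality; intros m; unfold seq_deriv, scal_seq; ring.
Qed.

Lemma l1_le_Series (x : nat -> R) :
  ex_series (fun m => Rabs (x m)) -> l1_le x (Series (fun m => Rabs (x m))).
Proof. intros H N; apply sum_le_Series; [intros; apply Rabs_pos|exact H]. Qed.

Lemma pair_weight_nonneg (l : nat) : 0 <= INR l * (INR l - 1) / 2.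
Proof.
destruct l as [|l]; [simpl; lra|].
rewrite S_INR; generalize (pos_INR l); nra.
Qed.

(** Terms with [l < k - 1] vanish, and [l = k - 1] contributes [(k - 1) (k - 2) / 2]. Multiplied by
    [k a], this isolated term is the middle summand of the bracket. *)
Lemma shifted_weight_series (k : nat) (d : nat -> R) (s : R) : (1 <= k)%nat ->
  Rabs (d 0%nat) = 1 ->
  is_series (fun j => INR (j + k) * (INR (j + k) - 1) / 2 * Rabs (d (S j))) s ->
  is_series (fun l => INR l * (INR l - 1) / 2 * Rabs (conv (delta (k - 1)) d l))
    ((INR k - 1) * (INR k - 2) / 2 + s).
Proof.
intros Hk Hd0 Hs; set (e := fun l => _).
assert (E : forall N, (N < k)%nat ->
  sum_f_R0 e N = if Nat.eqb N (k - 1) then (INR k - 1) * (INR k - 2) / 2 else 0).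
{ assert (He : forall N, (N < k)%nat -> e N = if Nat.eqb N (k - 1) then (INR k - 1) * (INR k - 2) / 2 else 0).
  { intros N HN; unfold e; rewrite conv_delta.
    destruct (Nat.eqb_spec N (k - 1)) as [->|Hne].
    - rewrite Nat.leb_refl, Nat.sub_diag, Hd0, minus_INR by lia; simpl (INR 1); field.
    - destruct (Nat.leb_spec (k - 1) N); [lia|]; rewrite Rabs_R0; ring. }
  induction N as [|N IH]; intros HN; cbn [sum_f_R0]; [apply He, HN|].
  rewrite IH, He by lia; destruct (Nat.eqb_spec N (k - 1)); [lia|]; ring. }
apply (is_series_decr_n e k); [lia|].
rewrite sum_n_Reals, E by lia.
destruct (Nat.eqb_spec (pred k) (k - 1)); [|lia].
unfold plus, opp; simpl.
replace (_ + s + - _) with s by ring.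
apply is_series_ext with (2 := Hs); intros j; unfold e.
rewrite conv_delta; destruct (Nat.leb_spec (k - 1) (k + j)); [|lia].
replace (k + j - (k - 1))%nat with (S j) by lia; rewrite (Nat.add_comm k j); reflexivity.
Qed.

Lemma dTV_bound_finite (k n : nat) (a s1 s2 tau : R) :
  (1 <= k)%nat -> (1 <= n)%nat -> 0 < a < 1 ->
  (forall m, 0 <= b_coef k a m) -> is_series (b_coef k a) (1 / a) ->
  1 - 2 * INR k * a + INR k * a ^ 2 > 0 ->
  let p := (1 - INR k * a) * a / (1 - (2 * INR k - 1) * a) in
  let alpha := INR n * (1 - INR k * a) ^ 2 / (1 - 2 * INR k * a + INR k * a ^ 2) in
  let q := 1 - p in
  let b := b_coef k a in
  let t := conv_pow n (scal_seq a b) in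
  is_series (fun l => INR l * (INR l - 1) / 2 * Rabs (b l - q * b (l - 1)%nat)) s1 ->
  is_series (fun j => INR (j + k) * (INR (j + k) - 1) / 2 * Rabs (b (j + 1)%nat - q * b j)) s2 ->
  l1_le (conv (seq_sub dirac0 (delta 1)) t) tau ->
  dTV t (nb_pmf alpha p) <= INR n / (alpha * q) *
    (s1 + INR k * (INR k - 1) * (INR k - 2) / 2 * a + INR k * a * s2) * tau.
Proof.
intros Hk Hn Ha Hb Hs HV p alpha q b t Hs1 Hs2 Htau.
assert (Hka := b_coef_mean_pos k a Hk Ha Hb Hs).
assert (HD : 0 < 1 - (2 * INR k - 1) * a).
{ assert (0 < a * (1 - INR k * a)) by (apply Rmult_lt_0_compat; lra); lra. }
assert (Hn1 : 1 <= INR n) by (change 1 with (INR 1); apply le_INR, Hn).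
assert (Hq : q = (1 - 2 * INR k * a + INR k * a ^ 2) / (1 - (2 * INR k - 1) * a))
  by (unfold q, p; field; lra).
assert (Hq0 : 0 < q) by (rewrite Hq; apply Rdiv_lt_0_compat; lra).
assert (Hp0 : 0 < p).
{ unfold p; apply Rdiv_lt_0_compat; [apply Rmult_lt_0_compat; lra|exact HD]. }
assert (Halpha : 0 < alpha).
{ unfold alpha; apply Rdiv_lt_0_compat; [|lra].
  apply Rmult_lt_0_compat; [lra|apply pow_lt; lra]. }
assert (Haq : 0 < alpha * q) by (apply Rmult_lt_0_compat; assumption).
(* Here [d] is [(1 - q z) B(z)], with the coefficients [b_l - q b_(l-1)] of the bracket, and [c] is
   the coefficient sequence of [c(z)]. *)
set (u := one_minus (INR k * a) (k - 1)); set (v := one_minus q 1).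
set (d := conv v b); set (c := conv u d).
assert (HB : abs_sum b (1 / a)) by (apply abs_sum_nonneg; assumption).
assert (HB' : abs_sum (seq_euler b) ((1 - INR k * a) / a ^ 2))
  by (apply b_coef_first_moment; trivial; lra).
assert (Hdsum := abs_sum_conv _ _ _ _ (abs_sum_one_minus q 1) HB).
assert (Hd'sum := abs_sum_euler_conv _ _ _ _ _ _ (abs_sum_one_minus q 1) HB
  (abs_sum_euler_one_minus q 1) HB').
fold v in Hdsum, Hd'sum; fold d in Hdsum, Hd'sum.
assert (Hcsum := abs_sum_conv _ _ _ _ (abs_sum_one_minus (INR k * a) (k - 1)) Hdsum).
assert (Hc'sum := abs_sum_euler_conv _ _ _ _ _ _ (abs_sum_one_minus (INR k * a) (k - 1)) Hdsum
  (abs_sum_euler_one_minus (INR k * a) (k - 1)) Hd'sum).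
fold u in Hcsum, Hc'sum; fold c in Hcsum, Hc'sum.
(* [p] and [alpha] are chosen so that the first two moments match, i.e. these two identities. *)
replace ((1 - INR k * a) * ((1 - q) * (1 / a))) with (alpha * q / INR n) in Hcsum
  by (rewrite Hq; unfold alpha; field; lra).
replace (_ + _) with 0 in Hc'sum.
2:{ rewrite minus_INR by exact Hk; simpl (INR 1); rewrite Hq; field; lra. }
assert (Hd0 : d 0%nat = 1).
{ unfold d, v; rewrite conv_one_minus; unfold seq_sub, scal_seq; rewrite conv_delta.
  unfold b; rewrite b_coef_0 by exact Hk; simpl; ring. }
assert (HdS : forall m, d (S m) = b (S m) - q * b m).
{ intros m; unfold d, v; rewrite conv_one_minus; unfold seq_sub, scal_seq; rewrite conv_delta.
  simpl; rewrite Nat.sub_0_r; reflexivity. }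
set (wt := fun l => INR l * (INR l - 1) / 2).
assert (Hwd : is_series (fun l => wt l * Rabs (d l)) s1).
{ apply is_series_ext with (2 := Hs1); intros [|m]; unfold wt.
  (* At [l = 0] the truncated index turns [b (l - 1)] into [b 0] and the term differs from [d 0],
     but the weight is 0. *)
  - simpl; unfold Rdiv; rewrite !Rmult_0_l; reflexivity.
  - rewrite HdS; simpl (S m - 1)%nat; rewrite Nat.sub_0_r; reflexivity. }
assert (Hwsd : is_series (fun l => wt l * Rabs (conv (delta (k - 1)) d l))
  ((INR k - 1) * (INR k - 2) / 2 + s2)).
{ apply shifted_weight_series; [exact Hk|rewrite Hd0; apply Rabs_R1|].
  apply is_series_ext with (2 := Hs2); intros j; rewrite HdS, Nat.add_1_r; reflexivity. }
assert (HW := is_series_add _ _ _ _ Hwd (is_series_scal_seq (INR k * a) _ _ Hwsd)).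
assert (Hka0 : 0 <= INR k * a) by (apply Rmult_le_pos; [apply pos_INR|lra]).
assert (Hwc : forall l, 0 <= wt l * Rabs (c l) <= seq_add (fun l => wt l * Rabs (d l))
  (scal_seq (INR k * a) (fun l => wt l * Rabs (conv (delta (k - 1)) d l))) l).
{ intros l; assert (Hl := pair_weight_nonneg l); fold (wt l) in Hl.
  split; [apply Rmult_le_pos; [exact Hl|apply Rabs_pos]|].
  unfold c, u; rewrite conv_one_minus; unfold seq_sub, seq_add, scal_seq.
  apply Rle_trans with (wt l * (Rabs (d l) + INR k * a * Rabs (conv (delta (k - 1)) d l))).
  - apply Rmult_le_compat_l; [exact Hl|].
    unfold Rminus; eapply Rle_trans; [apply Rabs_triang|].
    rewrite Rabs_Ropp, Rabs_mult, (Rabs_pos_eq (INR k * a)) by exact Hka0; lra.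
  - right; ring. }
assert (Hexc : ex_series (fun l => wt l * Rabs (c l))).
{ eapply (ex_series_le (fun l => wt l * Rabs (c l))); [|eexists; exact HW].
  intros l; unfold norm; simpl; unfold abs; simpl; rewrite Rabs_pos_eq; apply Hwc. }
assert (HWle : Series (fun l => wt l * Rabs (c l))
  <= s1 + INR k * (INR k - 1) * (INR k - 2) / 2 * a + INR k * a * s2).
{ replace (s1 + _ + _) with (s1 + INR k * a * ((INR k - 1) * (INR k - 2) / 2 + s2)) by field.
  rewrite <- (is_series_unique _ _ HW).
  apply Series_le; [exact Hwc|eexists; exact HW]. }
destruct (second_order_factor c _ Hcsum Hc'sum Hexc) as [K [HK HcK]].
set (f := scal_seq a b) in *.
assert (Hf : forall m, 0 <= f m) by (intros; apply Rmult_le_pos; [lra|apply Hb]).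
assert (Hf1 : abs_sum f 1) by (replace 1 with (a * (1 / a)) by (field; lra); apply abs_sum_scal, HB).
assert (Hf' : abs_sum (seq_euler f) (a * ((1 - INR k * a) / a ^ 2))).
{ replace (seq_euler f) with (scal_seq a (seq_euler b)); [apply abs_sum_scal, HB'|].
  apply functional_extensionality; intros m; unfold f, seq_euler, scal_seq; ring. }
(* Chosen so that [(1 - z) F = n (c(z) - c(1)) G]: one factor [1 - z] stays outside for the Stein
   step, the other is applied to [t]. *)
set (F := scal_seq (INR n) (conv K (conv (seq_sub dirac0 (delta 1)) t))).
assert (HF : l1_le F (INR n * (Series (fun l => wt l * Rabs (c l)) * tau))).
{ apply l1_le_scal; [lra|]; apply l1_le_conv; assumption. }
assert (Hrec : forall m, seq_deriv t m
  = (1 - p) * (alpha + INR m) * t m + conv (seq_sub dirac0 (delta 1)) F m).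
{ assert (E1 : seq_deriv t = scal_seq (INR n) (conv (conv u b) t)).
  { apply seq_deriv_pow, pgf_deriv, Hk. }
  assert (E2 : conv v (seq_deriv t) = seq_sub (seq_deriv t) (scal_seq q (seq_euler t))).
  { unfold v; rewrite conv_one_minus; do 2 f_equal.
    apply functional_extensionality; intros m; rewrite conv_delta.
    destruct m as [|m]; [unfold seq_euler; simpl; ring|].
    simpl Nat.leb; cbv iota; unfold seq_deriv, seq_euler.
    replace (S m - 1)%nat with m by lia; reflexivity. }
  assert (E3 : conv v (seq_deriv t) = scal_seq (INR n) (conv c t)).
  { rewrite E1, conv_scal_r; f_equal; unfold c, d; ring. }
  assert (E4 : conv (seq_sub dirac0 (delta 1)) F
    = scal_seq (INR n) (seq_sub (conv c t) (scal_seq (alpha * q / INR n) t))).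
  { unfold F; rewrite conv_scal_r; f_equal; rewrite scal_seq_conv.
    transitivity (conv (seq_sub c (seq_cst (alpha * q / INR n))) t); [rewrite HcK|]; ring. }
  intros m; rewrite E4; rewrite E2 in E3.
  assert (E5 := f_equal (fun g => g m) E3); cbv beta in E5.
  unfold seq_sub, scal_seq, seq_euler in E5 |- *; fold q.
  replace (INR n * (conv c t m - alpha * q / INR n * t m))
    with (INR n * conv c t m - alpha * q * t m) by (field; lra).
  lra. }
assert (Htau0 : 0 <= tau).
{ eapply Rle_trans; [|apply (Htau 0%nat)]; simpl; apply Rabs_pos. }
eapply Rle_trans.
- apply nb_stein_bound with (F := F) (s := INR n * (Series (fun l => wt l * Rabs (c l)) * tau));
    try assumption.
  + unfold q in Hq0; lra.
  + apply conv_pow_nonneg, Hf.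
  + apply abs_sum_pow, Hf1.
  + eexists; apply abs_sum_euler_pow; eassumption.
- fold q; unfold Rdiv.
  replace (INR n * (Series (fun l => wt l * Rabs (c l)) * tau) * / (alpha * q))
    with (INR n * / (alpha * q) * Series (fun l => wt l * Rabs (c l)) * tau) by ring.
  apply Rmult_le_compat_r; [exact Htau0|].
  apply Rmult_le_compat_l; [|exact HWle].
  apply Rmult_le_pos; [lra|apply Rlt_le, Rinv_0_lt_compat, Haq].
Qed.

(** * Infinite values of the bracket and conclusion *)

Lemma Lim_seq_sum_cases (x : nat -> R) : (forall m, 0 <= x m) ->
  (exists r, 0 <= r /\ Lim_seq (sum_f_R0 x) = Finite r /\ is_series x r)
  \/ Lim_seq (sum_f_R0 x) = p_infty.
Proof.
intros Hx.
assert (Hl : is_lim_seq (sum_f_R0 x) (Lim_seq (sum_f_R0 x))).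
{ apply Lim_seq_correct, ex_lim_seq_incr; intros n; simpl; specialize (Hx (S n)); lra. }
assert (H0 : Rbar_le 0 (Lim_seq (sum_f_R0 x))).
{ apply (is_lim_seq_le (fun _ => 0) (sum_f_R0 x)); [|apply is_lim_seq_const|exact Hl].
  intros n; apply cond_pos_sum, Hx. }
destruct (Lim_seq (sum_f_R0 x)) as [r| |]; [left|right; reflexivity|destruct H0].
exists r; split; [exact H0|split; [reflexivity|apply is_series_lim, Hl]].
Qed.

Lemma Rbar_mult_pos_p_infty (c : R) : 0 < c -> Rbar_mult (Finite c) p_infty = p_infty.
Proof.
intros Hc; apply is_Rbar_mult_unique; unfold is_Rbar_mult, Rbar_mult'.
destruct (Rle_dec 0 c) as [H|H]; [|lra].
destruct (Rle_lt_or_eq_dec 0 c H) as [H'|H']; [reflexivity|lra].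
Qed.

Lemma a_fun_bounds (k1 k2 : nat) (pb : R) : (k1 + k2 <> 0)%nat -> 0 < pb < 1 ->
  0 < a_fun k1 k2 pb < 1.
Proof.
intros Hk Hpb; unfold a_fun.
assert (H : forall x m, 0 < x < 1 -> 0 < x ^ m <= 1 /\ (m <> 0%nat -> x ^ m < 1)).
{ intros x m Hx; assert (Hp : 0 < x ^ m) by (apply pow_lt; lra).
  assert (Hlt : m <> 0%nat -> x ^ m < 1) by (intros; apply pow_lt_1_compat; [lra|lia]).
  split; [|exact Hlt]; split; [exact Hp|].
  destruct (Nat.eq_dec m 0) as [->|]; [simpl; lra|]; specialize (Hlt ltac:(assumption)); lra. }
destruct (H (1 - pb) k1 ltac:(lra)) as [H1 H1'], (H pb k2 ltac:(lra)) as [H2 H2'].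
split; [apply Rmult_lt_0_compat; lra|].
destruct (Nat.eq_dec k1 0) as [E|E].
- specialize (H2' ltac:(lia)); nra.
- specialize (H1' E); nra.
Qed.

Theorem theorem4p2 (k1 k2 n : nat) (pb : R) (f : nat -> R) :
  (k1 + k2 <> 0)%nat ->
  (1 <= n)%nat ->
  0 < pb < 1 ->
  let k := (k1 + k2)%nat in
  let a := a_fun k1 k2 pb in
  (* f is the pmf of hat T_1 (a Z_+-valued variable) with pgf a/(1 - z + a z^k) *)
  (forall m, 0 <= f m) ->
  (forall z, 0 <= z <= 1 -> is_series (fun m => f m * z ^ m) (a / (1 - z + a * z ^ k))) ->
  1 - 2 * INR k * a + INR k * a ^ 2 > 0 ->
  let p := (1 - INR k * a) * a / (1 - (2 * INR k - 1) * a) in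
  let alpha := INR n * (1 - INR k * a) ^ 2 / (1 - 2 * INR k * a + INR k * a ^ 2) in
  let q := 1 - p in
  let b := b_coef k a in
  let S1 := Lim_seq (fun N => sum_f_R0
              (fun l => INR l * (INR l - 1) / 2 *
                 Rabs (b l - q * b (l - 1)%nat)) N) in
  (* sum over l >= k, reindexed by l = j + k *)
  let S2 := Lim_seq (fun N => sum_f_R0
              (fun j => INR (j + k) * (INR (j + k) - 1) / 2 *
                 Rabs (b (j + 1)%nat - q * b j)) N) in
  let Cst := INR n / (alpha * q) * sqrt (2 / PI) *
             / sqrt (1 / 4 + INR n * (1 - a / 2 * (1 + a))) in
  Rbar_le (Finite (dTV (conv_pow n f) (nb_pmf alpha p)))
    (Rbar_mult (Finite Cst)
       (Rbar_plus
          (Rbar_plus S1 (Finite (INR k * (INR k - 1) * (INR k - 2) / 2 * a)))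
          (Rbar_mult (Finite (INR k * a)) S2))).
Proof.
intros Hk0 Hn Hpb k a Hf0 Hpgf HV p alpha q b S1 S2 Cst.
assert (Hk : (1 <= k)%nat) by (unfold k; lia).
assert (Ha : 0 < a < 1) by (apply a_fun_bounds; assumption).
assert (Hf : f = scal_seq a b) by (apply pgf_coefficients; trivial; lra).
(* Nonnegativity of the probabilities, passed on to [b], is the source of all growth estimates. *)
assert (Hb : forall m, 0 <= b m).
{ intros m; specialize (Hf0 m); rewrite Hf in Hf0; unfold scal_seq in Hf0; nra. }
assert (Hbs : is_series b (1 / a)).
{ assert (H := is_series_scal_seq (/ a) _ _ (Hpgf 1 ltac:(lra))).
  replace (/ a * _) with (1 / a) in H by (rewrite pow1; field; lra).
  apply is_series_ext with (2 := H); intros m.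
  rewrite Hf; unfold scal_seq; rewrite pow1; simpl; field; lra. }
assert (Hka : 0 < INR k * a) by (apply Rmult_lt_0_compat; [apply lt_0_INR; lia|lra]).
set (x1 := fun l => INR l * (INR l - 1) / 2 * Rabs (b l - q * b (l - 1)%nat)) in S1.
set (x2 := fun j => INR (j + k) * (INR (j + k) - 1) / 2 * Rabs (b (j + 1)%nat - q * b j)) in S2.
assert (Hx1 : forall l, 0 <= x1 l)
  by (intros; apply Rmult_le_pos; [apply pair_weight_nonneg|apply Rabs_pos]).
assert (Hx2 : forall l, 0 <= x2 l)
  by (intros; apply Rmult_le_pos; [apply pair_weight_nonneg|apply Rabs_pos]).
assert (Hv : 0 < 1 / 4 + INR n * (1 - a / 2 * (1 + a))).
{ assert (0 <= INR n * (1 - a / 2 * (1 + a))); [|lra].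
  apply Rmult_le_pos; [apply pos_INR|nra]. }
assert (Haq : 0 < alpha * q).
{ assert (Hka1 := b_coef_mean_pos k a Hk Ha Hb Hbs).
  assert (HD : 0 < 1 - (2 * INR k - 1) * a).
  { assert (0 < a * (1 - INR k * a)) by (apply Rmult_lt_0_compat; lra); lra. }
  replace (alpha * q) with (INR n * (1 - INR k * a) ^ 2 / (1 - (2 * INR k - 1) * a))
    by (unfold alpha, q, p; field; lra).
  apply Rdiv_lt_0_compat; [|exact HD].
  apply Rmult_lt_0_compat; [apply lt_0_INR; lia|apply pow_lt; lra]. }
assert (HCst : 0 < Cst).
{ unfold Cst; repeat apply Rmult_lt_0_compat.
  - apply lt_0_INR; lia.
  - apply Rinv_0_lt_compat, Haq.
  - apply sqrt_lt_R0, Rdiv_lt_0_compat; [lra|apply PI_RGT_0].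
  - apply Rinv_0_lt_compat, sqrt_lt_R0, Hv. }
(* If one of the series diverges, the right-hand side is [p_infty] because [Cst] and [k a] are
   positive; the case of two finite sums remains. *)
destruct (Lim_seq_sum_cases x1 Hx1) as [[s1 [Hs10 [E1 Hs1]]]|E1];
  destruct (Lim_seq_sum_cases x2 Hx2) as [[s2 [Hs20 [E2 Hs2]]]|E2];
  unfold S1, S2; change (fun N => sum_f_R0 x1 N) with (sum_f_R0 x1);
  change (fun N => sum_f_R0 x2 N) with (sum_f_R0 x2); rewrite E1, E2;
  try rewrite (Rbar_mult_pos_p_infty (INR k * a) Hka);
  simpl Rbar_plus; try rewrite (Rbar_mult_pos_p_infty Cst HCst); try exact I.
change (dTV (conv_pow n f) (nb_pmf alpha p)
  <= Cst * (s1 + INR k * (INR k - 1) * (INR k - 2) / 2 * a + INR k * a * s2)).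
rewrite Hf.
destruct (Nat.eq_dec k 1) as [Ek|Ek].
- (* For [k = 1] both laws coincide: [b l = q b (l - 1)]. *)
  assert (Hq : q = 1 - a).
  { unfold q, p; rewrite Ek; simpl (INR 1); field; lra. }
  assert (Hb0 : forall m, b (S m) - q * b m = 0).
  { intros m; rewrite Hq; unfold b; rewrite Ek, b_coef_S by lia.
    simpl; rewrite Nat.sub_0_r; ring. }
  assert (Z : forall x, (forall m, x m = 0) -> forall s, is_series x s -> s = 0).
  { intros x Hx s Hs; rewrite <- (is_series_unique _ _ Hs).
    apply is_series_unique, is_series_lim.
    apply is_lim_seq_ext with (u := fun _ => 0); [|apply is_lim_seq_const].
    induction n0 as [|N IH]; simpl; rewrite Hx; [|rewrite <- IH]; ring. }
  assert (Zs1 : s1 = 0).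
  { apply (Z x1); [|exact Hs1]; intros [|m]; unfold x1; [simpl; field|].
    replace (S m - 1)%nat with m by lia; rewrite Hb0, Rabs_R0; ring. }
  assert (Zs2 : s2 = 0).
  { apply (Z x2); [|exact Hs2]; intros m; unfold x2.
    rewrite Nat.add_1_r, Hb0, Rabs_R0; ring. }
  assert (Hf1 : abs_sum (scal_seq a b) 1).
  { replace 1 with (a * (1 / a)) by (field; lra).
    apply abs_sum_scal, abs_sum_nonneg; assumption. }
  (* [smoothness_bound] requires [k >= 2]; here the bracket is 0, so any finite l1 bound serves. *)
  assert (Ht := abs_sum_conv _ _ _ _ (abs_sum_one_minus 1 1) (abs_sum_pow n _ Hf1)).
  replace (one_minus 1 1) with (seq_sub dirac0 (delta 1)) in Ht
    by (apply functional_extensionality; intros m; unfold one_minus, seq_sub, scal_seq; ring).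
  eapply Rle_trans.
  + apply (dTV_bound_finite k n a s1 s2); try eassumption.
    apply l1_le_Series, (proj1 Ht).
  + right; rewrite Zs1, Zs2, Ek; simpl (INR 1); unfold Rdiv; ring.
- eapply Rle_trans.
  + apply (dTV_bound_finite k n a s1 s2); try eassumption.
    apply smoothness_bound; trivial; [lia|lra].
  + right; unfold Cst, q, alpha, p, Rdiv; ring.
Qed.
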